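(* Let $F$ be a finitely generated free group, let $G$ be a finitely generated residually finite amenable group, and let $\Gamma=F\rtimes G$ be a semidirect product (with $F$ normal in $\Gamma$). Then $\Gamma$ has a box space which embeds coarsely into Hilbert space; that is, there is a nested sequence $\{K_i\}$ of finite index normal subgroups of $\Gamma$ with trivial intersection such that $\Box_{\{K_i\}}\Gamma$ embeds coarsely into Hilbert space.
   Context: Coarse embedding: a metric space $(X,d_X)$ embeds coarsely in $(Y,d_Y)$ if there are a map $F:X\to Y$ and non-decreasing functions $\rho_\pm:\mathbb{R}_+\to\mathbb{R}_+$ with $\lim_{t\to\infty}\rho_\pm(t)=\infty$ and $\rho_-(d_X(x,x'))\le d_Y(F(x),F(x'))\le \rho_+(d_X(x,x'))$ for all $x,x'\in X$. Box space: let $\Gamma$ be a finitely generated residually finite group with a fixed finite generating set, and $\{K_i\}$ a nested sequence ($K_1\supseteq K_2\supseteq\cdots$) of finite index normal subgroups with trivial intersection. The box space $\Box_{\{K_i\}}\Gamma$ is the disjoint union $\sqcup_i \Gamma/K_i$, where each $\Gamma/K_i$ carries the word metric $d_i$ given by the image of the generating set of $\Gamma$, the distance $d(e_i,e_{i+1})$ between the identity elements $e_i\in\Gamma/K_i$ and $e_{i+1}\in \Gamma/K_{i+1}$ is chosen greater than the maximum of the diameters of $\Gamma/K_i$ and $\Gamma/K_{i+1}$, and for $\alpha\in\Gamma/K_i$, $\beta\in\Gamma/K_j$ with $i<j$ one sets $d(\alpha,\beta)=d_i(\alpha,e_i)+\sum_{k=i}^{j-1}d(e_k,e_{k+1})+d_j(e_j,\beta)$.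 *)

(* Defs.v *)
From HB Require Import structures.
From mathcomp Require Import all_boot all_order all_algebra finmap.
From mathcomp Require Import all_classical all_reals all_analysis.
From mathcomp Require Import lra.

Set Implicit Arguments.
Unset Strict Implicit.
Unset Printing Implicit Defensive.

Import Order.TTheory GRing.Theory Num.Theory.
Import numFieldNormedType.Exports.

Local Open Scope classical_set_scope.
Local Open Scope quotient_scope.
Local Open Scope group_scope.

Record normalSubgroup (G : groupType) := NormalSubgroup {
  nsub :> groupClosed G;
  nsub_conj : forall x y : G, x \in nsub -> x ^ y \in nsub
}.

Section Quotient.
Variables (G : groupType) (K : normalSubgroup G).

Definition coset_rel : rel G := fun x y => x^-1 * y \in K.

Lemma coset_rel_refl : reflexive coset_rel.
Proof. by move=> x; rewrite /coset_rel mulVg gpred1. Qed.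

Lemma coset_rel_sym : symmetric coset_rel.
Proof. by move=> x y; rewrite /coset_rel -gpredV invgM invgK. Qed.

Lemma coset_rel_trans : transitive coset_rel.
Proof.
move=> y x z; rewrite /coset_rel => xy yz.
by have := gpredM _ _ xy yz; rewrite -mulgA mulVKg.
Qed.

Canonical coset_equiv :=
  EquivRel coset_rel coset_rel_refl coset_rel_sym coset_rel_trans.

Definition quotientGroup := {eq_quot coset_equiv}.
HB.instance Definition _ := Choice.on quotientGroup.
HB.instance Definition _ := EqQuotient.on quotientGroup.

Definition coset (x : G) : quotientGroup := \pi_quotientGroup x.

Lemma cosetP (x y : G) : (coset x = coset y) <-> (x^-1 * y \in K).
Proof. by split=> [/eqmodP//|xy]; apply/eqmodP. Qed.

Lemma coset_ind (P : quotientGroup -> Prop) :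
  (forall x, P (coset x)) -> forall q, P q.
Proof. by move=> Px q; rewrite -[q]reprK; exact: Px. Qed.

Definition quot_one : quotientGroup := coset 1.
Definition quot_inv (p : quotientGroup) : quotientGroup := coset (repr p)^-1.
Definition quot_mul (p q : quotientGroup) : quotientGroup :=
  coset (repr p * repr q).

Lemma repr_coset x : (repr (coset x))^-1 * x \in K.
Proof. by apply/cosetP; rewrite /coset reprK. Qed.

Lemma quot_mulE x y : quot_mul (coset x) (coset y) = coset (x * y).
Proof.
apply/cosetP; set a := repr _; set b := repr _.
have -> : (a * b)^-1 * (x * y) = (a^-1 * x) ^ b * (b^-1 * y).
  by rewrite /conjg invgM !mulgA mulgK.
by apply: gpredM; [apply: nsub_conj|]; apply: repr_coset.
Qed.

Lemma quot_invE x : quot_inv (coset x) = coset x^-1.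
Proof.
apply/cosetP; set a := repr _; rewrite invgK.
have -> : a * x^-1 = (x^-1 * a) ^ x^-1 by rewrite /conjg invgK mulgA mulVKg.
by apply: nsub_conj; rewrite -gpredV invgM invgK; apply: repr_coset.
Qed.

Lemma quot_mulA : associative quot_mul.
Proof.
elim/coset_ind=> x; elim/coset_ind=> y; elim/coset_ind=> z.
by rewrite !quot_mulE mulgA.
Qed.

Lemma quot_mul1g : left_id quot_one quot_mul.
Proof. by elim/coset_ind=> x; rewrite quot_mulE mul1g. Qed.

Lemma quot_mulg1 : right_id quot_one quot_mul.
Proof. by elim/coset_ind=> x; rewrite quot_mulE mulg1. Qed.

Lemma quot_mulVg : left_inverse quot_one quot_inv quot_mul.
Proof. by elim/coset_ind=> x; rewrite quot_invE quot_mulE mulVg. Qed.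

Lemma quot_mulgV : right_inverse quot_one quot_inv quot_mul.
Proof. by elim/coset_ind=> x; rewrite quot_invE quot_mulE mulgV. Qed.

HB.instance Definition _ := isGroup.Build quotientGroup
  quot_mulA quot_mul1g quot_mulg1 quot_mulVg quot_mulgV.

Lemma cosetM x y : coset (x * y) = coset x * coset y.
Proof. by rewrite -quot_mulE. Qed.

Lemma cosetV x : coset x^-1 = (coset x)^-1.
Proof. by rewrite -quot_invE. Qed.

Lemma coset1 : coset 1 = 1.
Proof. by []. Qed.

Definition finite_index := finite_set [set: quotientGroup].

End Quotient.

Section Words.
Variable G : groupType.
Implicit Types (S w : seq G) (g x y : G).

Definition word_over S g w :=
  all [in S ++ [seq s^-1 | s <- S]] w && (\prod_(x <- w) x == g).

Definition generates S := forall g, exists w, word_over S g w.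

Definition finitely_generated := exists S, generates S.

Lemma word_size_ex S (gS : generates S) g :
  exists n, `[< exists2 w, word_over S g w & size w = n >].
Proof. by have [w gw] := gS g; exists (size w); apply/asboolP; exists w. Qed.

Definition word_length S (gS : generates S) g : nat :=
  ex_minn (word_size_ex gS g).

Definition word_dist S (gS : generates S) x y : nat :=
  word_length gS (x^-1 * y).

End Words.

Section WordTheory.
Variables (G : groupType) (S : seq G) (gS : generates S).
Implicit Types (g x y : G).

Lemma word_length_le g w : word_over S g w -> word_length gS g <= size w.
Proof.
move=> gw; rewrite /word_length; case: ex_minnP => n _; apply.
by apply/asboolP; exists w.
Qed.

Lemma word_length_ex g : exists2 w, word_over S g w & size w = word_length gS g.
Proof. by rewrite /word_length; case: ex_minnP => n /asboolP. Qed.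

Lemma word_length1 : word_length gS 1 = 0%N.
Proof.
apply/eqP; rewrite -leqn0; apply: (@word_length_le _ [::]).
by rewrite /word_over /= big_nil.
Qed.

Lemma word_length_eq0 g : word_length gS g = 0%N -> g = 1.
Proof.
have [w + <-] := word_length_ex g; rewrite /word_over => /andP[_ /eqP <-].
by move/size0nil => ->; rewrite big_nil.
Qed.

Lemma word_lengthM x y :
  word_length gS (x * y) <= word_length gS x + word_length gS y.
Proof.
have [u /andP[Su /eqP ux] <-] := word_length_ex x.
have [v /andP[Sv /eqP vy] <-] := word_length_ex y.
rewrite -size_cat; apply: word_length_le.
by rewrite /word_over all_cat Su Sv big_cat /= ux vy /=.
Qed.

Lemma word_lengthV_le x : word_length gS x^-1 <= word_length gS x.
Proof.
have [u /andP[Su /eqP ux] <-] := word_length_ex x.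
rewrite -(size_map (fun s => s^-1) u) -size_rev; apply: word_length_le.
apply/andP; split.
  apply/allP => z; rewrite mem_rev => /mapP[t tu ->].
  have := allP Su _ tu; rewrite /= !mem_cat => /orP[tS|/mapP[s sS ->]].
    by rewrite map_f ?orbT.
  by rewrite invgK sS.
apply/eqP; rewrite -ux; elim: u {Su ux} => [|a u IH] /=.
  by rewrite /rev /= !big_nil invg1.
by rewrite rev_cons -cats1 big_cat /= IH big_seq1 big_cons invgM.
Qed.

Lemma word_lengthV x : word_length gS x^-1 = word_length gS x.
Proof.
by apply/eqP; rewrite eqn_leq word_lengthV_le -{1}[x]invgK word_lengthV_le.
Qed.

Lemma word_distxx x : word_dist gS x x = 0%N.
Proof. by rewrite /word_dist mulVg word_length1. Qed.

Lemma word_dist_eq0 x y : word_dist gS x y = 0%N -> x = y.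
Proof. by move/word_length_eq0/(congr1 (fun z => x * z)); rewrite mulVKg mulg1. Qed.

Lemma word_distC x y : word_dist gS x y = word_dist gS y x.
Proof. by rewrite /word_dist -word_lengthV invgM invgK. Qed.

Lemma word_dist_triangle y x z :
  word_dist gS x z <= word_dist gS x y + word_dist gS y z.
Proof.
rewrite /word_dist; have -> : x^-1 * z = (x^-1 * y) * (y^-1 * z).
  by rewrite -mulgA mulVKg.
exact: word_lengthM.
Qed.

Lemma generates_quotient (K : normalSubgroup G) : generates (map (coset K) S).
Proof.
elim/coset_ind => g; have [w /andP[Sw /eqP <-]] := gS g.
exists (map (coset K) w); apply/andP; split.
  apply/allP => _ /mapP[t tw ->].
  have := allP Sw _ tw; rewrite /= !mem_cat => /orP[tS|/mapP[s sS ->]].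
    by rewrite map_f.
  by apply/orP; right; rewrite cosetV; do 2!apply: map_f.
rewrite big_map; apply/eqP; elim: {Sw}w => [|a w IH]; first by rewrite !big_nil.
by rewrite !big_cons cosetM IH.
Qed.

End WordTheory.

Section BoxSpace.
Variables (R : realType) (G : groupType) (S : seq G) (gS : generates S).
Variable K : nat -> normalSubgroup G.

Definition level_dist i (x y : quotientGroup (K i)) : R :=
  ((word_dist (@generates_quotient _ _ gS (K i)) x y)%:R)%R.

Definition level_diam i : R :=
  sup [set level_dist x y | x in [set: quotientGroup (K i)]
                          & y in [set: quotientGroup (K i)]].

(* gap i is the distance between the identity elements of levels i and i.+1. *)
Record box_gaps := BoxGaps {
  gap :> nat -> R;
  gap_gt : forall i, (Num.max (level_diam i) (level_diam i.+1) < gap i)%R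
}.

(* minn and maxn make the formula cover both orders of the levels of u and v;
   [tagged_as u v] is v cast to the level of u. *)
Definition box_dist (c : nat -> R) (u v : {i : nat & quotientGroup (K i)}) : R :=
  if tag u == tag v then level_dist (tagged u) (tagged_as u v)
  else (level_dist (tagged u) 1%g
        + \sum_(minn (tag u) (tag v) <= k < maxn (tag u) (tag v)) c k
        + level_dist 1%g (tagged v))%R.

Lemma level_distxx i (x : quotientGroup (K i)) : level_dist x x = 0%R.
Proof. by rewrite /level_dist word_distxx. Qed.

Lemma level_dist_eq0 i (x y : quotientGroup (K i)) :
  level_dist x y = 0%R -> x = y.
Proof. by move/eqP; rewrite pnatr_eq0 => /eqP/word_dist_eq0. Qed.

Lemma level_distC i (x y : quotientGroup (K i)) :
  level_dist x y = level_dist y x.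
Proof. by rewrite /level_dist word_distC. Qed.

Lemma level_dist_triangle i (y x z : quotientGroup (K i)) :
  (level_dist x z <= level_dist x y + level_dist y z)%R.
Proof. by rewrite /level_dist -natrD ler_nat word_dist_triangle. Qed.

Lemma level_dist_ge0 i (x y : quotientGroup (K i)) : (0 <= level_dist x y)%R.
Proof. exact: ler0n. Qed.

Lemma level_diam_ge0 i : (0 <= level_diam i)%R.
Proof.
rewrite /level_diam; set A := image2 _ _ _.
have A0 : A 0%R by exists 1%g => //; exists 1%g => //; rewrite level_distxx.
have [supA|nsupA] := pselect (has_sup A); last by rewrite sup_out.
exact: ub_le_sup supA.2 _ A0.
Qed.

Section BoxMetric.
Variable c : box_gaps.

Lemma gap_gt0 i : (0 < c i)%R.
Proof.
apply: le_lt_trans (gap_gt c i).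
by rewrite le_max level_diam_ge0.
Qed.

Let P n : R := (\sum_(0 <= k < n) c k)%R.

Let P_le m n : (m <= n)%N -> (P m <= P n)%R.
Proof.
move=> mn; rewrite /P (big_cat_nat (leq0n m) mn)//= lerDl sumr_ge0// => k _.
exact/ltW/gap_gt0.
Qed.

Let P_sum m n : (\sum_(minn m n <= k < maxn m n) c k = `|P m - P n|)%R.
Proof.
wlog mn : m n / (m <= n)%N.
  move=> W; have /orP[/W|/W] := leq_total m n; first by [].
  by rewrite minnC maxnC distrC.
rewrite (minn_idPl mn) (maxn_idPr mn) distrC ger0_norm ?subr_ge0 ?P_le//.
by rewrite /P [X in (X - _)%R](big_cat_nat (leq0n m) mn)//= addrAC subrr add0r.
Qed.

Lemma box_dist_same i (x y : quotientGroup (K i)) :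
  box_dist c (existT _ i x) (existT _ i y) = level_dist x y.
Proof. by rewrite /box_dist eqxx tagged_asE. Qed.

Let box_dist_diff u v : tag u != tag v ->
  box_dist c u v = (level_dist (tagged u) 1%g + `|P (tag u) - P (tag v)|
                    + level_dist (tagged v) 1%g)%R.
Proof.
by move=> /negPf uv; rewrite /box_dist uv P_sum (level_distC 1%g).
Qed.

Lemma box_distxx u : box_dist c u u = 0%R.
Proof. by case: u => i x; rewrite box_dist_same level_distxx. Qed.

Lemma box_dist_eq0 u v : box_dist c u v = 0%R -> u = v.
Proof.
have [|uv] := eqVneq (tag u) (tag v).
  case: u v => [i x] [j y] /= ij; case: j / ij y => y.
  by rewrite box_dist_same => /level_dist_eq0 ->.
rewrite /box_dist (negPf uv) => /eqP; rewrite gt_eqF//.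
rewrite ltr_wpDr ?level_dist_ge0// ltr_wpDl ?level_dist_ge0//.
have mM : (minn (tag u) (tag v) < maxn (tag u) (tag v))%N.
  move: uv; rewrite neq_ltn => /orP[] lt_uv.
    by rewrite (minn_idPl (ltnW lt_uv)) (maxn_idPr (ltnW lt_uv)).
  by rewrite (minn_idPr (ltnW lt_uv)) (maxn_idPl (ltnW lt_uv)).
rewrite big_ltn// ltr_pwDl ?gap_gt0// sumr_ge0// => k _.
exact/ltW/gap_gt0.
Qed.

Lemma box_distC u v : box_dist c u v = box_dist c v u.
Proof.
have [|uv] := eqVneq (tag u) (tag v).
  case: u v => [i x] [j y] /= ij; case: j / ij y => y.
  by rewrite !box_dist_same level_distC.
rewrite !box_dist_diff ?[tag v == _]eq_sym// distrC.
by rewrite addrAC [RHS]addrAC [X in (X + _)%R]addrC.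
Qed.

Lemma box_dist_triangle v u w :
  (box_dist c u w <= box_dist c u v + box_dist c v w)%R.
Proof.
have a0 := fun t : {i : nat & quotientGroup (K i)} =>
  level_dist_ge0 (tagged t) 1%g.
have [uw|uw] := eqVneq (tag u) (tag w).
  case: u w uw a0 => [i x] [j z] /= ij; case: j / ij z => z a0.
  have [iv|iv] := eqVneq i (tag v).
    case: v iv => j y /= iv; case: j / iv y => y.
    by rewrite !box_dist_same level_dist_triangle.
  rewrite box_dist_same !box_dist_diff//= 1?eq_sym//.
  have := level_dist_triangle 1%g x z; rewrite [level_dist 1%g z]level_distC.
  have := a0 v; have := normr_ge0 (P i - P (tag v))%R.
  have := normr_ge0 (P (tag v) - P i)%R; lra.
have [uv|uv] := eqVneq (tag u) (tag v).
  case: u v uv uw a0 => [i x] [j y] /= ij; case: j / ij y => y iw a0.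
  rewrite box_dist_same !box_dist_diff//=.
  have := level_dist_triangle y x 1%g; lra.
have [vw|vw] := eqVneq (tag v) (tag w).
  case: v w vw uw uv a0 => [i y] [j z] /= ij; case: j / ij z => z ui _ a0.
  rewrite box_dist_same !box_dist_diff//=.
  have := level_dist_triangle y z 1%g; rewrite [level_dist z y]level_distC; lra.
rewrite !box_dist_diff//.
have := ler_distD (P (tag v)) (P (tag u)) (P (tag w)); have := a0 v; lra.
Qed.

End BoxMetric.

Definition box_space (c : box_gaps) := {i : nat & quotientGroup (K i)}.
HB.instance Definition _ c := Choice.on (box_space c).
HB.instance Definition _ c := isMetric.Build R (box_space c)
  (@box_distxx c) (@box_dist_eq0 c) (@box_distC c) (@box_dist_triangle c).

End BoxSpace.

(* Only the restriction of rho to the nonnegative reals matters. *)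
Definition coarse_control (R : realType) (rho : R -> R) :=
  [/\ forall t, (0 <= t)%R -> (0 <= rho t)%R,
      forall s t, (0 <= s)%R -> (s <= t)%R -> (rho s <= rho t)%R
    & rho t @[t --> +oo%R] --> +oo%R].

Definition coarse_embedding (R : realType) (X Y : Type)
    (dX : X -> X -> R) (dY : Y -> Y -> R) (f : X -> Y) :=
  exists rho_m rho_p : R -> R,
    [/\ coarse_control rho_m, coarse_control rho_p &
        forall x x', (rho_m (dX x x') <= dY (f x) (f x') <= rho_p (dX x x'))%R].

Definition is_hilbert (R : realType) (H : completeNormedModType R) :=
  exists dotp : {dot H for (@idfun R)}%R,
    forall u : H, (dotp u u = `|u| ^+ 2)%R.

Definition embeds_coarsely_in_Hilbert (R : realType) (X : metricType R) :=
  exists (H : completeNormedModType R) (f : X -> H),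
    is_hilbert H /\ coarse_embedding mdist (fun u v : H => `|u - v|%R) f.

(* The universal property of the free group on B; the values of f outside B
   are irrelevant. *)
Definition free_basis (F : groupType) (B : set F) :=
  forall (H : groupType) (f : F -> H),
    (exists phi : {multiplicative F -> H}, {in B, phi =1 f}) /\
    (forall phi psi : {multiplicative F -> H},
        {in B, phi =1 psi} -> phi =1 psi).

Definition free_group (F : groupType) := exists B : set F, free_basis B.

Definition residually_finite (G : groupType) :=
  forall g : G, g <> 1 ->
    exists N : normalSubgroup G, finite_index N /\ g \notin N.

Local Open Scope fset_scope.
(* The Folner condition: A is almost invariant under left translation by E. *)
Definition amenable (R : realType) (G : groupType) :=
  forall (E : {fset G}) (eps : R), (0 < eps)%R ->
    exists2 A : {fset G}, A != fset0 &
      forall g, g \in E ->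
        let gA := [fset (g * a)%g | a in A] in
        ((#|` (gA `\` A) `|` (A `\` gA)|)%:R <= eps * (#|` A|)%:R)%R.
Local Close Scope fset_scope.

(* E is the internal semidirect product of its normal subgroup iota(N) and its
   subgroup sigma(Q). *)
Definition semidirect_product (N Q E : groupType)
    (iota : {multiplicative N -> E}) (sigma : {multiplicative Q -> E}) :=
  [/\ injective iota, injective sigma,
      forall (x : N) (g : E), exists y, iota x ^ g = iota y,
      forall x q, iota x = sigma q -> iota x = 1
    & forall g, exists x q, g = iota x * sigma q].

(* Main.v *)
Require Import Defs.
From HB Require Import structures.
From mathcomp Require Import all_boot all_order all_algebra finmap.
From mathcomp Require Import all_classical all_reals all_analysis.
From mathcomp Require Import ring lra.

(** Put [N_0 = F] and let [N_(i+1)] be the intersection of the kernels of all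
    homomorphisms from [N_i] to Z/2 ([homology_tower]).  These subgroups are
    stable under every endomorphism of [F], in particular under the action of
    [G].  Shrink a residual chain of [G] to a chain [M_i] that acts trivially
    on [F / N_(i+1)]; then [K_i = N_(i+1) M_i] ([box_subgroup]) is a normal
    subgroup of finite index in [Gamma], and [Gamma / K_i] is the semidirect
    product of [F / N_(i+1)] by [G / M_i].

    The metric of [F / N_(i+1)] can be read off the Cayley graph of [F / N_i].
    A path from 1 to [x] in that graph has a mod 2 chain of edges
    ([path_chain]), which changes by one edge when [x] is multiplied by a basis
    element and which determines [x] modulo [N_(i+1)].  So the number of edges
    in which the chains of [x] and [y] differ is at most their distance.
    Conversely ([homology_subgroup_close]), if the chains differ in at most
    [r] edges and the graph has no closed path of length at most [r], then [x]
    and [y] are at distance at most [r] modulo [N_(i+1)]: these few edges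
    contain no cycle, so they form a path from [x] to [y].  The girth of
    [F / N_i] exceeds [i] ([homology_tower_girth]), which makes the comparison
    uniform in [i].  As a Hamming distance [d] gives the positive definite
    kernel [rho ^ d] for [rho] in [0, 1], the groups [F / N_(i+1)] are
    uniformly embeddable.

    To pass from [F] to [Gamma], average this kernel over a Folner set [A] of
    [G] ([average_kernel]): a coset of [F] in [Gamma / K_i] is reached from a
    point [g] by right multiplication by some [a] in [A], and the kernel on [F]
    compares the points of that coset reached from [g] and from [h].
    Almost invariance of [A] makes the value at [g], [g s] close to 1 for each
    generator [s], with [rho] chosen close to 1 after [A].  A value above 1/2
    forces some pair of points in a common coset to be close, hence [g] and [h]
    to be close, with a bound that depends on [A] and [rho] but not on [i].

    Adding such kernels for a summable sequence of errors gives maps of the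
    levels to the Hilbert space [l2] that are uniformly Lipschitz and uniformly
    proper ([level_vectors]).  One more coordinate records the sum of the gaps
    below a level; since a gap exceeds the diameters of the two levels that it
    joins, this coordinate controls the distance between distinct levels
    ([box_space_embeds]). *)

Set Implicit Arguments.
Unset Strict Implicit.
Unset Printing Implicit Defensive.

Import Order.TTheory GRing.Theory Num.Theory.
Import numFieldNormedType.Exports.

Local Open Scope classical_set_scope.
Local Open Scope group_scope.

(** * Groups, generation and free bases *)

Section Morphism.
Variables (G H : groupType) (f : G -> H) (fM : {morph f : x y / x * y}).

Lemma morph1 : f 1 = 1.
Proof. by apply: (@mulIg _ (f 1)); rewrite -fM !mul1g. Qed.

Lemma morphV x : f x^-1 = (f x)^-1.
Proof. by apply: (@mulIg _ (f x)); rewrite -fM !mulVg morph1. Qed.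

End Morphism.

Section FiniteRange.
Variables (X : Type).

Lemma finite_range_pair (T U : choiceType) (f : X -> T) (g : X -> U) :
  finite_set (range f) -> finite_set (range g) ->
  finite_set (range (fun x => (f x, g x))).
Proof.
move=> ff fg; apply: sub_finite_set (finite_setX ff fg) => _ [x _ <-].
by split; exists x.
Qed.

Lemma finite_range_comp (T U : choiceType) (f : X -> T) (g : T -> U) :
  finite_set (range f) -> finite_set (range (g \o f)).
Proof.
move=> ff; apply: sub_finite_set (finite_image g ff) => _ [x _ <-].
by exists (f x) => //; exists x.
Qed.

Lemma finite_range_map (J : Type) (T : choiceType) (f : J -> X -> T) (s : seq J) :
  (forall j, finite_set (range (f j))) ->
  finite_set (range (fun x => [seq f j x | j <- s])).
Proof.
move=> ff; elim: s => [|j s IH] /=.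
  by apply: sub_finite_set (finite_set1 [::]) => _ [x _ <-].
exact: (finite_range_comp (fun p => p.1 :: p.2) (finite_range_pair (ff j) IH)).
Qed.

Lemma finite_range_bool (f : X -> bool) : finite_set (range f).
Proof. exact: finite_finset. Qed.

End FiniteRange.

Section MakeNormal.
Variables (G : groupType) (P : G -> Prop).
Hypotheses (P1 : P 1) (PM : forall x y, P x -> P y -> P (x * y)).
Hypotheses (PV : forall x, P x -> P x^-1).

(** The boolean form of a [Prop]-valued predicate: [groupClosed], and so
    [normalSubgroup] and the subgroup type below, speak of boolean
    predicates. *)
Definition mem_prop : {pred G} := fun x => `[< P x >].

Fact mem_prop_mul : mulg_closed mem_prop.
Proof. by move=> x y /asboolP Px /asboolP Py; apply/asboolP; exact: PM. Qed.
Fact mem_prop1 : 1 \in mem_prop. Proof. exact/asboolP. Qed.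
Fact mem_prop_inv : invg_closed mem_prop.
Proof. by move=> x /asboolP Px; apply/asboolP; exact: PV. Qed.

HB.instance Definition _ := isMulClosed.Build G mem_prop mem_prop_mul.
HB.instance Definition _ := isMul1Closed.Build G mem_prop mem_prop1.
HB.instance Definition _ := isInvClosed.Build G mem_prop mem_prop_inv.

Record prop_group := PropGroup { pgval :> G; _ : pgval \in mem_prop }.
HB.instance Definition _ := [isSub for pgval].
HB.instance Definition _ := [Choice of prop_group by <:].
Fact mem_prop_group_closed : group_closed mem_prop.
Proof.
split; first exact: mem_prop1.
by move=> x y xP yP; apply: mem_prop_mul => //; exact: mem_prop_inv.
Qed.
HB.instance Definition _ :=
  SubChoice_isSubGroup.Build G mem_prop prop_group mem_prop_group_closed.

(** If [P] defines a subgroup that contains the basis, the universal property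
    gives a homomorphism from [G] to that subgroup which is the identity on the
    basis; followed by the inclusion it is the identity of [G]. *)
Lemma free_basis_ind (B : set G) :
  free_basis B -> (forall b, B b -> P b) -> forall x, P x.
Proof.
move=> fB BP x.
have [[phi phiB] _] := fB prop_group (insubd (1 : prop_group)).
have [_ uniq] := fB G id.
have /(_ x) : (val \o phi : {multiplicative G -> G}) =1 idfun.
  apply: uniq => b /[dup] bB; rewrite inE => Bb /=.
  rewrite phiB// val_insubd ifT//; exact/asboolP/BP.
by move=> /= <-; case: (phi x) => y /= /asboolP.
Qed.

Hypothesis PJ : forall x y, P x -> P (x ^ y).

Fact mem_prop_conj (x y : G) : x \in mem_prop -> x ^ y \in mem_prop.
Proof. by move=> /asboolP Px; apply/asboolP; exact: PJ. Qed.

Definition make_normal : normalSubgroup G := NormalSubgroup mem_prop_conj.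

Lemma make_normalP x : (x \in make_normal) <-> P x.
Proof. by split=> [/asboolP|Px]; [|apply/asboolP]. Qed.

End MakeNormal.

Section FiniteIndex.
Variables (G : groupType) (K : normalSubgroup G).

(** The fibres of [f] refine the cosets of [K], so there are at most as many
    cosets as values of [f]. *)
Lemma finite_index_fun (T : choiceType) (f : G -> T) :
  finite_set (range f) -> (forall x y, f x = f y -> x^-1 * y \in K) ->
  finite_index K.
Proof.
move=> ff fK; pose g t := coset K (xget 1 [set x | f x = t]).
apply: sub_finite_set (finite_image g ff) => q _.
elim/coset_ind: q => x; exists (f x); first by exists x.
apply/cosetP/fK; by case: xgetP => [y _ //|/(_ x)/= []].
Qed.

Lemma finite_index_range : finite_index K -> finite_set (range (coset K)).
Proof. exact: sub_finite_set. Qed.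

End FiniteIndex.

Section Generation.
Variables (G : groupType).

Lemma generates_ind (S : seq G) (P : G -> Prop) : generates S ->
  P 1 -> (forall x y, P x -> P y -> P (x * y)) -> (forall x, P x -> P x^-1) ->
  {in S, forall s, P s} -> forall x, P x.
Proof.
move=> gS P1 PM PV PS x; have [w /andP[Sw /eqP <-]] := gS x => {x}.
elim: w Sw => [|a w IH] /=; first by rewrite big_nil.
move=> /andP[Sa Sw]; rewrite big_cons; apply: PM; last exact: IH.
move: Sa; rewrite mem_cat => /orP[/PS//|/mapP[s sS ->]]; exact/PV/PS.
Qed.

Lemma word_over_sub (S T : seq G) x w :
  {subset S <= T} -> word_over S x w -> word_over T x w.
Proof.
rewrite /word_over => ST /andP[Sw ->]; rewrite andbT; apply: sub_all Sw => a.
rewrite /= !mem_cat => /orP[/ST ->//|/mapP[s /ST sT ->]].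
by rewrite map_f ?orbT.
Qed.

Lemma word_overM (S : seq G) x y v w :
  word_over S x v -> word_over S y w -> word_over S (x * y) (v ++ w).
Proof.
move=> /andP[Sv /eqP <-] /andP[Sw /eqP <-].
by rewrite /word_over all_cat Sv Sw big_cat /=.
Qed.

Lemma word_overV (S : seq G) x w :
  word_over S x w -> word_over S x^-1 (rev [seq s^-1 | s <- w]).
Proof.
move=> /andP[Sw /eqP <-]; apply/andP; split; last first.
  apply/eqP; elim: w {Sw} => [|a w IH]; first by rewrite !big_nil invg1.
  by rewrite /= rev_cons -cats1 big_cat IH big_seq1 big_cons invgM.
apply/allP => z; rewrite mem_rev => /mapP[t tw ->].
have := allP Sw _ tw; rewrite /= !mem_cat => /orP[tS|/mapP[s sS ->]].
  by rewrite map_f ?orbT.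
by rewrite invgK sS.
Qed.

Lemma word_over1 (S : seq G) : word_over S 1 [::].
Proof. by rewrite /word_over big_nil eqxx. Qed.

Lemma word_over_letter (S : seq G) x : x \in S -> word_over S x [:: x].
Proof. by move=> xS; rewrite /word_over /= mem_cat xS big_seq1 eqxx. Qed.

End Generation.

Section FiniteBasis.
Variable F : groupType.

(** A basis element outside [Bs] could be sent to 1 in the additive group of
    the integers while all other basis elements go to 0; such a homomorphism
    kills [Bs], hence everything. *)
Lemma free_basis_sub (B : set F) (Bs : seq F) : free_basis B ->
  [set` Bs] `<=` B -> generates Bs -> B = [set` Bs].
Proof.
move=> fB BsB gBs; apply/seteqP; split => //= b Bb; apply/negPn/negP => bBs.
pose H := Algebra.to_multiplicative int.
(* a nontrivial element of the integers, written multiplicatively *)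
pose t : H := 1%R : int.
have [[phi phiB] _] := fB H (fun x => if x == b then t else 1%g).
have phi1 x : phi x = 1%g.
  apply: (generates_ind (P := fun x => phi x = 1%g) gBs) => {x} [|x y|x|x xBs].
  - exact/morph1/gmulfM.
  - by rewrite gmulfM => -> ->; rewrite mulg1.
  - by move=> x1; rewrite (morphV (@gmulfM _ _ phi)) x1 invg1.
  - rewrite phiB; last by rewrite inE; exact: BsB.
    by case: eqP => // xb; rewrite -xb xBs in bBs.
have := phiB b; rewrite inE => /(_ Bb); rewrite phi1 eqxx.
by move=> /(congr1 (fun x : H => (x : int) == 0%R)).
Qed.

(** Finitely many generators are words in finitely many basis elements. *)
Lemma finite_free_basis : free_group F -> finitely_generated F ->
  exists B : seq F, free_basis [set` B] /\ generates B.
Proof.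
move=> [B fB] [S gS].
pose P x := exists Bs w, [set` Bs] `<=` B /\ word_over Bs x w.
have Bw : forall x, P x.
  apply: (free_basis_ind _ _ _ fB).
  - by exists [::], [::]; split=> //; exact: word_over1.
  - move=> x y [Bx [u [BxB xu]]] [By [v [ByB yv]]]; exists (Bx ++ By), (u ++ v).
    split=> [z /=|]; first by rewrite mem_cat => /orP[/BxB|/ByB].
    apply: word_overM; [apply: word_over_sub xu|apply: word_over_sub yv] => z;
      by rewrite mem_cat => ->; rewrite ?orbT.
  - by move=> x [Bx [u [BxB xu]]]; exists Bx; eexists; split=> //; exact: word_overV xu.
  - move=> b Bb; exists [:: b], [:: b]; split; last by apply: word_over_letter;
    rewrite inE.
    by move=> z /=; rewrite inE => /eqP ->.
have [Bs [BsB SBs]] : exists Bs, [set` Bs] `<=` B /\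
    forall s, s \in S -> exists w, word_over Bs s w.
  elim: (S) => [|s T [Bs [BsB TBs]]]; first by exists [::].
  have [Bx [u [BxB xu]]] := Bw s; exists (Bx ++ Bs); split=> [z /=|t].
    by rewrite mem_cat => /orP[/BxB|/BsB].
  rewrite inE => /orP[/eqP ->|/TBs[w tw]].
    by exists u; apply: word_over_sub xu => z; rewrite mem_cat => ->.
  by exists w; apply: word_over_sub tw => z; rewrite mem_cat => ->; rewrite orbT.
have gBs : generates Bs.
  apply: (generates_ind gS) => [|x y [u xu] [v yv]|x [u xu]|s /SBs //].
  - by exists [::]; exact: word_over1.
  - by exists (u ++ v); exact: word_overM.
  - by eexists; exact: word_overV xu.
by exists Bs; split => //; rewrite -(free_basis_sub fB BsB gBs).
Qed.

End FiniteBasis.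

(** * Mod 2 chains of paths and the homology tower of a free group *)

Section BigXor.
Variable I : Type.

Lemma big_addbD (r : seq I) (f g : I -> bool) :
  \big[addb/false]_(i <- r) (f i (+) g i) =
  \big[addb/false]_(i <- r) f i (+) \big[addb/false]_(i <- r) g i.
Proof. exact: big_split. Qed.

Lemma big_addb_ex (r : seq I) (f : I -> bool) :
  \big[addb/false]_(i <- r) f i -> has f r.
Proof.
elim: r => [|i r IH]; first by rewrite big_nil.
by rewrite big_cons /=; case: (f i) => //=; exact: IH.
Qed.

End BigXor.

Lemma big_addb_delta (I : eqType) (r : seq I) (i0 : I) (f : I -> bool) :
  uniq r -> i0 \in r -> (forall i, i != i0 -> f i = false) ->
  \big[addb/false]_(i <- r) f i = f i0.
Proof.
move=> ur ir f0; rewrite (bigD1_seq i0)//= big1_seq ?addbF// => i /andP[i0i _].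
exact: f0.
Qed.

(** Removing from the chain [d] one edge that it contains. *)
Lemma count_flip (I : eqType) (r : seq I) (i0 : I) (d : pred I) :
  uniq r -> i0 \in r -> d i0 ->
  count d r = (count (fun i => d i (+) (i == i0)) r).+1.
Proof.
move=> ur ir di0; rewrite !(permP (perm_to_rem ir)) /= di0 eqxx/= add0n add1n.
congr _.+1; apply: eq_in_count => i; rewrite mem_rem_uniq// inE => /andP[/negPf/= -> _].
by rewrite addbF.
Qed.

Section MagnusGroup.
Variables (F : groupType) (N : normalSubgroup F).

(** Mod 2 chains of edges in the Cayley graph of [F / N]: the pair [(v, s)]
    stands for the edge from [v] to [v s].  The second component ranges over
    all of [F] instead of the basis; the chains of interest are supported on
    basis elements. *)
Definition chain := (quotientGroup N * F -> bool).

Definition translate (x : F) (c : chain) : chain :=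
  fun e => c ((coset N x)^-1 * e.1, e.2).

(** The semidirect product of the chains by [F], acting by translations: the
    mod 2 Magnus representation, through which chains of paths are defined by
    the universal property. *)
Definition magnus := (chain * F)%type.
HB.instance Definition _ := Choice.on magnus.

Definition magnus_one : magnus := (fun=> false, 1).
Definition magnus_mul (p q : magnus) : magnus :=
  (fun e => p.1 e (+) translate p.2 q.1 e, p.2 * q.2).
Definition magnus_inv (p : magnus) : magnus := (translate p.2^-1 p.1, p.2^-1).

Lemma translateM x y c e : translate (x * y) c e = translate x (translate y c) e.
Proof. by rewrite /translate /= cosetM invgM mulgA. Qed.

Lemma translate1 c e : translate 1 c e = c e.
Proof. by rewrite /translate coset1 invg1 mul1g; case: e. Qed.

Fact magnus_mulA : associative magnus_mul.
Proof.
move=> p q r; congr pair; last exact: mulgA.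
by apply/funext => e; rewrite /= translateM addbA.
Qed.

Fact magnus_mul1 : left_id magnus_one magnus_mul.
Proof.
move=> [c x]; congr pair; last exact: mul1g.
by apply/funext => e; rewrite /= translate1.
Qed.

Fact magnus_mulr1 : right_id magnus_one magnus_mul.
Proof.
move=> [c x]; congr pair; last exact: mulg1.
by apply/funext => e; rewrite /= addbF.
Qed.

Fact magnus_mulV : left_inverse magnus_one magnus_inv magnus_mul.
Proof.
move=> [c x]; congr pair; last exact: mulVg.
by apply/funext => e; rewrite /= addbb.
Qed.

Fact magnus_mulrV : right_inverse magnus_one magnus_inv magnus_mul.
Proof.
move=> [c x]; congr pair; last exact: mulgV.
by apply/funext => e; rewrite /= -translateM mulgV translate1 addbb.
Qed.

HB.instance Definition _ := isGroup.Build magnus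
  magnus_mulA magnus_mul1 magnus_mulr1 magnus_mulV magnus_mulrV.

End MagnusGroup.

Section PathChain.
Variables (F : groupType) (B : seq F) (fB : free_basis [set` B]).
Variable N : normalSubgroup F.

(** Send a basis element [s] to the edge from 1 to [s], paired with [s].  The
    second component of the resulting homomorphism is the identity of [F] by
    uniqueness, so the first one is a crossed homomorphism. *)
Lemma path_chain_subproof : {b : F -> chain N |
  (forall x y e, b (x * y) e = b x e (+) translate x (b y) e) /\
  (forall s e, s \in B -> b s e = (e == (1, s)))}.
Proof.
apply: cid.
have [[phi phiB] _] := fB (fun s => (fun e => e == (1, s), s) : magnus N).
have [_ uniq] := fB (fun s : F => s).
have phi2 : (snd \o phi : F -> F) =1 idfun.
  have sndM : {morph (snd \o phi : F -> F) : x y / x * y}.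
    by move=> x y /=; rewrite gmulfM.
  pose sndphi := HB.pack_for {multiplicative F -> F} (snd \o phi : F -> F)
    (isMultiplicative.Build F F (snd \o phi) sndM).
  by apply: (uniq sndphi idfun) => s sB; rewrite /= phiB.
exists (fun x => (phi x).1); split=> [x y e|s e sB].
  by rewrite gmulfM /=; have /= -> := phi2 x.
by rewrite phiB ?inE.
Qed.

(** The mod 2 chain of the path of [x] from 1 in the Cayley graph of [F / N],
    that is, the mod 2 Fox derivative of [x]. *)
Definition path_chain : F -> chain N := projT1 path_chain_subproof.
Local Notation b := path_chain.

Lemma path_chainM x y e : b (x * y) e = b x e (+) translate x (b y) e.
Proof. by have [] := projT2 path_chain_subproof. Qed.

Lemma path_chain_basis s e : s \in B -> b s e = (e == (1, s)).
Proof. by have [_ ] := projT2 path_chain_subproof; apply. Qed.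

Lemma path_chain1 e : b 1 e = false.
Proof. by have := path_chainM 1 1 e; rewrite translate1 mulg1; case: (b 1 e). Qed.

(** A letter carries its exponent: [true] for the basis element itself,
    [false] for its inverse. *)
Definition letter (l : F * bool) : F := if l.2 then l.1 else l.1^-1.
Definition word_val (w : seq (F * bool)) : F := \prod_(l <- w) letter l.
Definition letters (w : seq (F * bool)) := all (fun l => l.1 \in B) w.
Definition word_ball n x := exists w, [/\ letters w, size w <= n & x = word_val w].

(** The edge traversed from [x] by the letter [l]; an inverse letter traverses
    backwards an edge that starts at the other end. *)
Definition edge (x : F) (l : F * bool) : quotientGroup N * F :=
  (if l.2 then coset N x else coset N (x * l.1^-1), l.1).

Lemma path_chain_step x l e : l.1 \in B ->
  b (x * letter l) e = b x e (+) (e == edge x l).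
Proof.
have D y s : s \in B -> b (y * s) e = b y e (+) (e == (coset N y, s)).
  move=> sB; rewrite path_chainM /translate (path_chain_basis _ sB); congr addb.
  case: e => v t; apply/eqP/eqP => [[yv ->]|[-> ->]] /=.
    by congr pair; apply: (@mulgI _ (coset N y)^-1); rewrite yv mulVg.
  by rewrite mulVg.
case: l => s [] sB; rewrite /letter /edge /=; first exact: D.
have := D (x * s^-1) s sB; rewrite mulgVK => ->.
by rewrite -addbA addbb addbF.
Qed.

Lemma word_val_cons l w : word_val (l :: w) = letter l * word_val w.
Proof. exact: big_cons. Qed.

Lemma word_val_cat v w : word_val (v ++ w) = word_val v * word_val w.
Proof. exact: big_cat. Qed.

Hypothesis gB : generates B.

Lemma generates_word x : exists w, letters w /\ x = word_val w.
Proof.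
have [w /andP[Bw /eqP <-]] := gB x => {x}.
elim: w Bw => [|t w IH] /=; first by exists [::]; rewrite /word_val !big_nil.
move=> /andP[Bt /IH[u [Bu wu]]]; rewrite big_cons wu.
move: Bt; rewrite mem_cat => /orP[tB|/mapP[s sB ->]].
  by exists ((t, true) :: u); rewrite /letters /= tB word_val_cons.
by exists ((s, false) :: u); rewrite /letters /= sB word_val_cons.
Qed.

(** The equivalence in the step takes care of inverse letters. *)
Lemma generates_step_ind (P : F -> Prop) : P 1 ->
  (forall x s, s \in B -> P x <-> P (x * s)) -> forall x, P x.
Proof.
move=> P1 PS x; have [w [Bw ->]] := generates_word x.
elim/last_ind: w Bw => [|w [s c] IH]; first by rewrite /word_val big_nil.
rewrite /letters all_rcons => /andP[/= sB /IH Pw].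
rewrite /word_val big_rcons -/(word_val w) /letter /=.
case: c; first exact: (PS _ _ sB).1.
by apply: (PS _ _ sB).2; rewrite mulgVK.
Qed.

Lemma path_chain_support x e : b x e -> e.2 \in B.
Proof.
move: x; apply: generates_step_ind => [|x s sB]; first by rewrite path_chain1.
have := path_chain_step (l := (s, true)) x e sB.
by rewrite /letter/edge /= => ->; case: eqP => [->|_]; rewrite ?addbF.
Qed.

(** The parity of the number of edges of [d] at the vertex [v]; a loop counts
    twice. *)
Definition boundary (d : chain N) (v : quotientGroup N) : bool :=
  \big[addb/false]_(s <- undup B) (d (v, s) (+) d (v * (coset N s)^-1, s)).

Lemma boundaryD d d' v :
  boundary (fun e => d e (+) d' e) v = boundary d v (+) boundary d' v.
Proof. by rewrite /boundary -big_addbD; apply: eq_bigr => s _; rewrite addbACA. Qed.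

Lemma boundary_edge x l v : l.1 \in B ->
  boundary (fun e => e == edge x l) v =
  (v == coset N x) (+) (v == coset N (x * letter l)).
Proof.
case: l => s c /= sB;
  rewrite /boundary (@big_addb_delta _ _ s) ?undup_uniq ?mem_undup//=.
  rewrite /edge /letter !xpair_eqE /= !eqxx !andbT.
  have E (u w : quotientGroup N) : (u * w^-1 == v) = (v * w == u).
    by rewrite divg_eq eq_sym.
  rewrite divg_eq.
  case: c; first by rewrite cosetM.
  by rewrite -cosetM mulgVK addbC.
by move=> t ts; rewrite /edge !xpair_eqE /= (negPf ts) !andbF.
Qed.

Lemma boundary_path_chain x v : boundary (b x) v = (v == 1) (+) (v == coset N x).
Proof.
move: x; apply: generates_step_ind => [|x s sB].
  by rewrite coset1 addbb /boundary big1// => s _; rewrite !path_chain1.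
have -> : b (x * s) = (fun e => b x e (+) (e == edge x (s, true))).
  by apply/funext => e; rewrite -(path_chain_step _ _ (l := (s, true))).
rewrite boundaryD boundary_edge//= /letter/=.
case: (boundary _ _); case: (v == 1); case: (v == coset N x);
  by case: (v == coset N (x * s)); split.
Qed.

Variable Es : seq (quotientGroup N * F).
Hypotheses (uEs : uniq Es) (mEs : forall e, (e \in Es) = (e.2 \in B)).

Definition chain_dist x y := count (fun e => b x e (+) b y e) Es.

(** A chain with odd degree exactly at two vertices contains a path between
    them: leave the first vertex by an edge of [d], remove this edge, and
    continue.  The number of edges bounds the length of the walk. *)
Lemma walk n x y (d : chain N) :
  count d Es <= n -> (forall e, d e -> e.2 \in B) ->
  (forall v, boundary d v = (v == coset N x) (+) (v == coset N y)) ->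
  exists w, [/\ letters w, size w <= n, coset N (x * word_val w) = coset N y &
    forall e, b (x * word_val w) e != b x e -> d e].
Proof.
elim: n x d => [|n IH] x d dn dB bd.
all: have [xy|xy] := eqVneq (coset N x) (coset N y).
1,3: by exists [::]; rewrite /word_val big_nil mulg1; split => // e; rewrite eqxx.
all: have := bd (coset N x); rewrite eqxx (negPf xy) => /big_addb_ex/hasP[s].
all: rewrite mem_undup => sB ds.
(* in both cases of the induction, [d] has an edge at [x] *)
all: have [c dc] : exists c, d (edge x (s, c)).
  1,3: move: ds; case ds: (d (coset N x, s)); first by exists true.
  1,2: by exists false; rewrite /edge /= cosetM cosetV.
all: have eE : edge x (s, c) \in Es by rewrite mEs.
  by move: dn; rewrite (count_flip uEs eE dc).
pose d' : chain N := fun e => d e (+) (e == edge x (s, c)).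
have dn' : count d' Es <= n by move: dn; rewrite (count_flip uEs eE dc).
have dB' e : d' e -> e.2 \in B.
  by rewrite /d'; case: eqP => [->//|_]; rewrite addbF; exact: dB.
have bd' v : boundary d' v = (v == coset N (x * letter (s, c))) (+) (v == coset N y).
  rewrite /d' boundaryD bd boundary_edge//.
  by case: (v == coset N x); case: (v == coset N y); case: (v == _).
have [w [Bw wn wy bw]] := IH _ _ dn' dB' bd'.
exists ((s, c) :: w); split => //=; first by rewrite /letters /= sB.
- by rewrite word_val_cons mulgA.
- move=> e; rewrite word_val_cons mulgA => be.
  have [->//|ee] := eqVneq e (edge x (s, c)).
  have := bw e; rewrite /d' (negPf ee) addbF; apply.
  by move: be; rewrite [in X in _ -> X]path_chain_step// (negPf ee) addbF.
Qed.

(** No nontrivial element of length at most [r] lies in [N]: up to backtracking,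
    the Cayley graph of [F / N] has no closed path of length at most [r]. *)
Definition girth_gt r := forall x, x \in N -> word_ball r x -> x = 1.

Lemma cosetMr x z : coset N (x * z) = coset N x -> z \in N.
Proof. by move/esym/cosetP; rewrite mulKg. Qed.

(** If the chains of [x] and [y] differ in an edge [e], their difference is a
    cycle through [e].  Walking from one end of [e] to the other inside the
    cycle without [e], and closing up by [e], yields a short element of [N],
    which is 1 by the girth condition; but its path traverses [e] exactly
    once. *)
Lemma closed_chain r x y : girth_gt r -> coset N x = coset N y ->
  chain_dist x y <= r -> b x =1 b y.
Proof.
move=> gr xy xyr e; apply/eqP/negPn/negP => bxy.
pose d : chain N := fun e => b x e (+) b y e.
have de : d e by move: bxy; rewrite /d; case: (b x e); case: (b y e).
have dB e' : d e' -> e'.2 \in B.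
  by rewrite /d; case bx: (b x e');
    rewrite ?(path_chain_support bx)// => /path_chain_support.
have eE : e \in Es by rewrite mEs; exact: dB.
case: r gr xyr => [|r] gr; rewrite /chain_dist (count_flip uEs eE de) // ltnS => d'r.
(* [e] goes from [w] to [w * e.2] *)
pose w := repr e.1; have we : coset N w = e.1 by rewrite /coset reprK.
have sB := dB _ de.
have eedge : e = edge w (e.2, true) by rewrite /edge /= we; case: (e).
have [|v|u [Bu ur uw bu]] := walk (x := w * e.2) (y := w) d'r.
- by move=> e'; case: eqP => [->//|_]; rewrite addbF; exact: dB.
- rewrite boundaryD {1}/d boundaryD !boundary_path_chain xy addbb.
  have := boundary_edge w (l := (e.2, true)) v sB; rewrite -eedge => ->.
  by rewrite addFb addbC /letter.
have e2u : e.2 * word_val u = 1.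
  apply: gr; first by apply: (@cosetMr w); rewrite mulgA.
  by exists ((e.2, true) :: u); rewrite /letters /= sB word_val_cons.
have := bu e; rewrite eqxx de -mulgA e2u mulg1.
have /= -> := path_chain_step w e (l := (e.2, true)) sB.
by rewrite -eedge eqxx; case: (b w e) => /(_ isT).
Qed.

(** Walk from [x] inside the difference of the two chains up to the vertex of
    [y]; what remains of the difference is a short cycle, hence empty. *)
Lemma chain_dist_le r x y : girth_gt r -> chain_dist x y <= r ->
  exists z, [/\ word_ball r z, coset N (x * z) = coset N y & b (x * z) =1 b y].
Proof.
move=> gr xyr; have dB e : b x e (+) b y e -> e.2 \in B.
  by case bx: (b x e); rewrite ?(path_chain_support bx)// => /path_chain_support.
have [|w [Bw wr wy bw]] := walk (x := x) (y := y) (d :=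
  fun e => b x e (+) b y e) xyr dB.
  by move=> v; rewrite boundaryD !boundary_path_chain addbACA addbb.
exists (word_val w); split => //; first by exists w.
apply: closed_chain gr wy _; apply: leq_trans xyr.
apply: sub_count => e /= be.
case xy: (b x e (+) b y e) => //; suff : b x e (+) b y e by rewrite xy.
by apply: bw; apply: contraTneq be => ->; rewrite xy.
Qed.

Lemma chain_dist_word x w : letters w -> chain_dist x (x * word_val w) <= size w.
Proof.
elim: w x => [|l w IH] x /=.
  by rewrite /word_val big_nil mulg1 leqn0 /chain_dist -(count_pred0 Es);
    rewrite (eq_count (a2 := pred0))// => e; rewrite /= addbb.
move=> /andP[lB /(IH (x * letter l)) xw]; rewrite word_val_cons mulgA.
apply: (@leq_trans (count (pred1 (edge x l)) Es + chain_dist (x * letter l) (x * letter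
  l * word_val w))).
  rewrite /chain_dist -[X in _ <= X]count_predUI; apply: leq_trans (leq_addr _ _).
  apply: sub_count => e /=; rewrite path_chain_step//.
  by case: (e == _); rewrite ?addbF.
by rewrite count_uniq_mem// mEs lB.
Qed.

(** An edge in which the chains of the ends of a path differ is traversed by
    the path. *)
Lemma path_chain_word x w e : letters w -> b (x * word_val w) e != b x e ->
  exists w1 l w2, w = w1 ++ l :: w2 /\ edge (x * word_val w1) l = e.
Proof.
elim: w x => [|l w IH] x /=; first by rewrite /word_val big_nil mulg1 eqxx.
move=> /andP[lB Bw]; rewrite word_val_cons mulgA => be.
have [el|el] := eqVneq e (edge x l).
  by exists [::], l, w; rewrite /word_val big_nil mulg1.
have [|w1 [l' [w2 [-> el']]]] := IH (x * letter l) Bw.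
  by rewrite path_chain_step// (negPf el) addbF.
by exists (l :: w1), l', w2; rewrite word_val_cons mulgA.
Qed.

End PathChain.

Section Derive.
Variables (F : groupType) (N : normalSubgroup F).

(** Homomorphisms from [N] to Z/2, as maps that are defined on all of [F] and
    constrained on [N] only. *)
Definition hom2_on (chi : F -> bool) :=
  forall x y, x \in N -> y \in N -> chi (x * y) = chi x (+) chi y.

Definition hom2_kernel x := x \in N /\ forall chi, hom2_on chi -> chi x = false.

Lemma hom2_on1 chi : hom2_on chi -> chi 1 = false.
Proof. by move=> /(_ 1 1 gpred1 gpred1); rewrite mulg1; case: (chi 1). Qed.

Lemma hom2_onV chi x : hom2_on chi -> x \in N -> chi x^-1 = chi x.
Proof.
move=> hchi xN; have := hom2_on1 hchi; rewrite -(mulgV x) hchi// ?gpredV//.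
by case: (chi x); case: (chi _).
Qed.

Lemma hom2_kernel_endo (f : F -> F) x : {morph f : y z / y * z} ->
  (forall y, y \in N -> f y \in N) -> hom2_kernel x -> hom2_kernel (f x).
Proof.
move=> fM fN [xN x0]; split=> [|chi hchi]; first exact: fN.
by apply: (x0 (chi \o f)) => u v uN vN /=; rewrite fM hchi// fN.
Qed.

Fact hom2_kernel1 : hom2_kernel 1.
Proof. by split=> [|chi /hom2_on1]; first exact: gpred1. Qed.

Fact hom2_kernelM x y : hom2_kernel x -> hom2_kernel y -> hom2_kernel (x * y).
Proof.
move=> [xN x0] [yN y0]; split=> [|chi hchi]; first exact: gpredM.
by rewrite hchi// x0// y0.
Qed.

Fact hom2_kernelV x : hom2_kernel x -> hom2_kernel x^-1.
Proof.
by move=> [xN x0]; split=> [|chi hchi]; [rewrite gpredV|rewrite hom2_onV// x0].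
Qed.

Fact hom2_kernelJ x y : hom2_kernel x -> hom2_kernel (x ^ y).
Proof.
apply: (hom2_kernel_endo (f := fun x => x ^ y)) => [u v|u]; first exact: conjMg.
exact: nsub_conj.
Qed.

(** For [N] of finite index, the quotient [N / homology_subgroup N] is the
    first homology of [N] with coefficients in Z/2. *)
Definition homology_subgroup : normalSubgroup F :=
  make_normal hom2_kernel1 hom2_kernelM hom2_kernelV hom2_kernelJ.

Lemma homology_subgroupP x : x \in homology_subgroup <-> hom2_kernel x.
Proof. exact: make_normalP. Qed.

Lemma homology_subgroup_sub : {subset homology_subgroup <= N}.
Proof. by move=> x /homology_subgroupP[]. Qed.

(** A homomorphism from [N] to Z/2 can be pulled back along [f]. *)
Lemma homology_subgroup_endo (f : F -> F) : {morph f : y z / y * z} ->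
  (forall y, y \in N -> f y \in N) ->
  forall y, y \in homology_subgroup -> f y \in homology_subgroup.
Proof.
move=> fM fN y /homology_subgroupP yN'; apply/homology_subgroupP.
exact: hom2_kernel_endo.
Qed.

Lemma coset_eq1 x : (coset N x = 1) <-> (x \in N).
Proof. by rewrite -coset1; split=> [/esym/cosetP|xN]; [|apply/esym/cosetP];
  rewrite invg1 mul1g. Qed.

Variables (B : seq F) (fB : free_basis [set` B]) (gB : generates B).
Local Notation b := (@path_chain _ _ fB N).

Lemma path_chainM_in x y e : x \in N -> b (x * y) e = b x e (+) b y e.
Proof.
move=> /coset_eq1 x1; rewrite path_chainM /translate.
rewrite x1 invg1 mul1g.
by case: e.
Qed.

(** On [N] each coefficient of the chain is a homomorphism to Z/2, because [N]
    fixes all vertices. *)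
Lemma homology_subgroup_chain x e : x \in homology_subgroup -> b x e = false.
Proof.
move=> /homology_subgroupP[_ x0]; apply: (x0 (fun x => b x e)) => u v uN _.
exact: path_chainM_in.
Qed.

(** The chain of a word of length at most [n + 1] in the homology subgroup vanishes, so
    the first edge is traversed again.  The loop between the two traversals is
    a shorter element of [N], hence trivial; cutting it out leaves a word of
    length at most [n] for the same element, which is therefore trivial. *)
Lemma homology_subgroup_girth n :
  girth_gt B N n -> girth_gt B homology_subgroup n.+1.
Proof.
move=> gn x xN' [[|l w] [Bw wn xw]]; first by rewrite xw /word_val big_nil.
have xN := homology_subgroup_sub xN'.
have small v : letters B v -> size v <= n -> x = word_val v -> x = 1.
  by move=> Bv vn xv; apply: gn => //; exists v.
move: Bw wn => /= /andP[lB Bw]; rewrite ltnS => wn; move: xw;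
  rewrite word_val_cons => xw.
have bl : b (letter l) (edge N 1 l) = true.
  by rewrite -[letter l]mul1g path_chain_step// path_chain1 eqxx.
have [|w1 [l' [w2 [ww el]]]] := @path_chain_word _ _ fB N (letter l) w (edge N 1 l) Bw.
  by rewrite bl -xw homology_subgroup_chain.
move: Bw wn; rewrite ww /letters all_cat size_cat /= => /and3P[Bw1 lB' Bw2] wn.
have xE : x = letter l * word_val w1 * letter l' * word_val w2.
  by rewrite xw ww word_val_cat word_val_cons !mulgA.
(* the edge is traversed twice in the same direction *)
have simple1 : letter l * word_val w1 \in N -> x = 1.
  move=> pN; have p1 : letter l * word_val w1 = 1.
    apply: gn => //; exists (l :: w1); split; rewrite /letters /= ?lB ?word_val_cons//.
    by apply: leq_trans wn; rewrite addnS ltnS leq_addr.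
  apply: (small (l' :: w2)); rewrite ?word_val_cons.
  - by rewrite /letters /= lB'.
  - by apply: leq_trans wn; exact: leq_addl.
  - by rewrite xE p1 mul1g.
(* the edge is traversed back *)
have simple2 : letter l' = (letter l)^-1 -> word_val w1 \in N -> x = 1.
  move=> l'l pN; have p1 : word_val w1 = 1.
    by apply: gn => //; exists w1; split=> //; apply: leq_trans wn; exact: leq_addr.
  apply: (small w2) => //; first by apply: leq_trans wn;
    rewrite addnS ltnW// ltnS leq_addl.
  by rewrite xE p1 mulg1 l'l mulgV mul1g.
case: l l' {lB lB' bl ww small xw} xE simple1 simple2 el => s [] [t []] /=;
  rewrite /edge /letter/= ?mul1g => xE simple1 simple2 [e1 e2].
- by apply: simple1; apply/coset_eq1; rewrite e1 coset1.
- subst t; apply: simple2 => //; apply/coset_eq1.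
  move: (congr1 (fun v => v * coset N s) e1); rewrite !cosetM cosetV mulgVK mul1g.
  by move=> e1'; apply: (@mulgI _ (coset N s)); rewrite mulg1.
- subst t; apply: simple2 => //; first by rewrite invgK.
  apply/coset_eq1; apply: (@mulgI _ (coset N s^-1)).
  by rewrite mulg1 -cosetM e1.
- subst t; apply: simple1; apply/coset_eq1; apply: (@mulIg _ (coset N s^-1)).
  by rewrite mul1g -cosetM e1.
Qed.

Variable Es : seq (quotientGroup N * F).
Hypotheses (uEs : uniq Es) (mEs : forall e, (e \in Es) = (e.2 \in B)).

(** Every homomorphism [chi] from [N] to Z/2 comes from a cochain [phi] on the
    edges: with coset representatives [t], the edge from [v] to [v s] gets the
    value of [chi] at [t v * s * (t (v s))^-1], and [chi x] is the sum of [phi]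
    over the chain of [x]. *)
Lemma chain_homology_subgroup x :
  x \in N -> (forall e, b x e = false) -> x \in homology_subgroup.
Proof.
move=> xN x0; apply/homology_subgroupP; split => // chi hchi.
pose t (v : quotientGroup N) : F := repr v.
have tN v y : (t v * y * (t (v * coset N y))^-1) \in N.
  apply/coset_eq1; rewrite !cosetM cosetV.
  have tE u : coset N (t u) = u by rewrite /coset reprK.
  by rewrite !tE mulgV.
pose phi e := chi (t e.1 * e.2 * (t (e.1 * coset N e.2))^-1).
have key y : chi (t 1 * y * (t (coset N y))^-1) =
    \big[addb/false]_(e <- Es) (b y e && phi e).
  move: y; apply: (generates_step_ind gB).
    rewrite mulg1 coset1 mulgV hom2_on1// big1// => e _; by rewrite path_chain1.
  move=> y s sB.
  have -> : \big[addb/false]_(e <- Es) (b (y * s) e && phi e) =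
      \big[addb/false]_(e <- Es) (b y e && phi e) (+) phi (coset N y, s).
    have eE : (coset N y, s) \in Es by rewrite mEs.
    have -> : phi (coset N y, s) =
        \big[addb/false]_(e <- Es) ((e == (coset N y, s)) && phi e).
      by rewrite (big_addb_delta uEs eE) ?eqxx// => e /negPf ->.
    rewrite -big_addbD; apply: eq_bigr => e _.
    have /= -> := path_chain_step fB y (l := (s, true)) e sB.
    by rewrite andb_addl.
  have -> : t 1 * (y * s) * (t (coset N (y * s)))^-1 =
      (t 1 * y * (t (coset N y))^-1) * (t (coset N y) * s * (t (coset N (y * s)))^-1).
    by rewrite !mulgA mulgVK.
  have tN1 : t 1 * y * (t (coset N y))^-1 \in N by have := tN 1 y; rewrite mul1g.
  have := tN (coset N y) s; rewrite -cosetM => /(hchi _ _ tN1) ->.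
  by rewrite /phi /= -cosetM; split=> [->//|]; exact: addIb.
have t1N : t 1 \in N by apply/coset_eq1; rewrite /coset reprK.
have := key x; rewrite big1; last by move=> e _; rewrite x0.
have /coset_eq1 -> := xN.
by rewrite !hchi ?gpredV ?gpredM// hom2_onV// addbAC addbb.
Qed.

Lemma chain_eq_homology_subgroup x y : coset N x = coset N y -> b x =1 b y ->
  x^-1 * y \in homology_subgroup.
Proof.
move=> /cosetP xyN bxy; apply: chain_homology_subgroup => // e.
have := path_chainM fB x (x^-1 * y) (coset N x * e.1, e.2).
by rewrite mulVKg bxy /translate /= mulKg; case: (e) => v s /=; case: (b y _);
  case: (b _ _).
Qed.

Lemma homology_subgroup_finite_index :
  finite_index N -> finite_index homology_subgroup.
Proof.
move=> fN.
apply: (@finite_index_fun _ _ _ (fun x => (coset N x, [seq b x e | e <- Es]))).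
  apply: finite_range_pair; first exact: finite_index_range.
  by apply: finite_range_map => e; exact: finite_range_bool.
move=> x y [xy bxy]; apply: chain_eq_homology_subgroup => // e.
have [eE|eE] := boolP (e \in Es); first by have /eq_in_map := bxy; apply.
rewrite mEs in eE.
case bx: (b x e); first by rewrite (path_chain_support gB bx) in eE.
by case bY: (b y e) => //; rewrite (path_chain_support gB bY) in eE.
Qed.

(** The quotient metric modulo [homology_subgroup N] is controlled by the
    Hamming distance of chains, up to the girth of [F / N]. *)
Lemma homology_subgroup_close r x y : girth_gt B N r ->
  chain_dist fB Es x y <= r ->
  exists2 z, word_ball B r z & (x * z)^-1 * y \in homology_subgroup.
Proof.
move=> gr /(chain_dist_le gB uEs mEs gr)[z [zr xzy bxzy]].
by exists z => //; exact: chain_eq_homology_subgroup.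
Qed.

End Derive.

Lemma edge_enum (F : groupType) (B : seq F) (N : normalSubgroup F) :
  finite_index N -> exists Es : seq (quotientGroup N * F),
    uniq Es /\ forall e, (e \in Es) = (e.2 \in B).
Proof.
move=> /finite_seqP[Vs VsE]; exists (undup [seq (v, s) | v <- Vs, s <- B]).
split=> [|[v s]]; first exact: undup_uniq.
have vV : v \in Vs by have : [set: quotientGroup N] v by []; rewrite VsE.
rewrite mem_undup; apply/allpairsP/idP => [[[u t] [_ tB [_ ->]]] //|sB].
by exists (v, s).
Qed.

Section Tower.
Variables (F : groupType) (B : seq F).
Hypotheses (fB : free_basis [set` B]) (gB : generates B).

Definition whole_group (G : groupType) : normalSubgroup G :=
  @make_normal G (fun=> True) I (fun _ _ _ _ => I) (fun _ _ => I) (fun _ _ _ => I).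

Lemma whole_group_finite_index (G : groupType) : finite_index (whole_group G).
Proof.
apply: (@finite_index_fun _ _ _ (fun=> false)); first exact: finite_range_bool.
by move=> x y _; apply/make_normalP.
Qed.

Fixpoint homology_tower i : normalSubgroup F :=
  if i is j.+1 then homology_subgroup (homology_tower j) else whole_group F.

Lemma homology_tower_endo (f : F -> F) i : {morph f : y z / y * z} ->
  forall y, y \in homology_tower i -> f y \in homology_tower i.
Proof.
move=> fM; elim: i => [|i IH] /=; last exact: homology_subgroup_endo.
by move=> y _; apply/make_normalP.
Qed.

Lemma homology_tower_finite_index i : finite_index (homology_tower i).
Proof.
elim: i => [|i IH] /=; first exact: whole_group_finite_index.
have [Es [uEs mEs]] := edge_enum B IH.
exact: homology_subgroup_finite_index uEs mEs IH.
Qed.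

(** In particular the subgroups of the tower intersect trivially. *)
Lemma homology_tower_girth i : girth_gt B (homology_tower i) i.
Proof.
elim: i => [|i IH] /=; last exact: homology_subgroup_girth.
by move=> x _ [w [_]]; rewrite leqn0 => /nilP -> ->; rewrite /word_val big_nil.
Qed.

Lemma homology_tower_girth_le i r : r <= i -> girth_gt B (homology_tower i) r.
Proof.
move=> ri x xN [w [Bw wr xw]]; apply: (@homology_tower_girth i) => //.
by exists w; split=> //; exact: leq_trans ri.
Qed.

Lemma homology_tower_trivial x : (forall i, x \in homology_tower i) -> x = 1.
Proof.
move=> xN; have [w [Bw xw]] := generates_word gB x.
by apply: (@homology_tower_girth (size w)) => //; exists w.
Qed.

End Tower.

(** * The Hilbert space of square summable sequences *)

Section SquareSummable.
Local Open Scope ring_scope.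
Variable R : realType.

Definition square_summable : {pred (nat -> R)} := fun u =>
  `[< exists M : R, forall n, \sum_(0 <= k < n) u k ^+ 2 <= M >].

Lemma square_summableP (u : nat -> R) :
  reflect (exists M : R, forall n, \sum_(0 <= k < n) u k ^+ 2 <= M)
          (u \in square_summable).
Proof. exact: asboolP. Qed.

Lemma square_summable_submod : submod_closed square_summable.
Proof.
split; first by apply/square_summableP; exists 0 => n; rewrite big1// => k _;
  rewrite expr0n.
move=> a u v /square_summableP[M uM] /square_summableP[N vN].
apply/square_summableP; exists (2 * a ^+ 2 * M + 2 * N) => n.
apply: (@le_trans _ _ (2 * a ^+ 2 * (\sum_(0 <= k < n) u k ^+ 2) +
                       2 * (\sum_(0 <= k < n) v k ^+ 2))).
  rewrite !mulr_sumr -big_split/=; apply: ler_sum => k _.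
  have -> : (a *: u + v) k = a * u k + v k by [].
  have := sqr_ge0 (a * u k - v k); nra.
apply: lerD; first by rewrite ler_wpM2l// mulr_ge0// sqr_ge0.
by rewrite ler_wpM2l.
Qed.

HB.instance Definition _ :=
  GRing.isSubmodClosed.Build R (nat -> R) square_summable square_summable_submod.

Record l2 := L2 { l2val :> nat -> R; l2P : l2val \in square_summable }.
HB.instance Definition _ := [isSub for l2val].
HB.instance Definition _ := [Choice of l2 by <:].
HB.instance Definition _ := [SubChoice_isSubLmodule of l2 by <:].


Definition l2_dot (u v : l2) : R := limn (fun n => \sum_(0 <= k < n) u k * v k).

Lemma l2_sqr_cvg (u : l2) : cvgn (fun n => \sum_(0 <= k < n) u k ^+ 2).
Proof.
apply: nondecreasing_is_cvgn.
  apply/nondecreasing_seqP => n; rewrite big_nat_recr//= lerDl; exact: sqr_ge0.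
by have /square_summableP[M uM] := l2P u; exists M => _ [n _ <-].
Qed.

(** Polarization reduces convergence to that of series of squares. *)
Lemma l2_dot_cvg (u v : l2) :
  (fun n => \sum_(0 <= k < n) u k * v k) @ \oo --> l2_dot u v.
Proof.
suff : cvgn (fun n => \sum_(0 <= k < n) u k * v k) by [].
have -> : (fun n => \sum_(0 <= k < n) u k * v k) =
    (fun n => 2^-1 * (\sum_(0 <= k < n) (u + v : l2) k ^+ 2
      - \sum_(0 <= k < n) u k ^+ 2 - \sum_(0 <= k < n) v k ^+ 2)).
  apply/funext => n; rewrite -!sumrB mulr_sumr; apply: eq_bigr => k _.
  have -> : (u + v : l2) k = u k + v k by [].
  by field.
apply: is_cvgM; first exact: is_cvg_cst.
apply: is_cvgB; last exact: l2_sqr_cvg.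
by apply: is_cvgB; exact: l2_sqr_cvg.
Qed.

Lemma l2_dotE (u v : l2) (l : R) :
  (fun n => \sum_(0 <= k < n) u k * v k) @ \oo --> l -> l2_dot u v = l.
Proof. exact: cvg_lim. Qed.

Lemma l2_dotC (u v : l2) : l2_dot u v = l2_dot v u.
Proof.
by rewrite /l2_dot; congr (limn _); apply/funext => n; apply: eq_bigr => k _;
  rewrite mulrC.
Qed.

Lemma l2_dotPl (a : R) (u v w : l2) :
  l2_dot (a *: u + v) w = a * l2_dot u w + l2_dot v w.
Proof.
apply: l2_dotE.
have -> : (fun n => \sum_(0 <= k < n) (a *: u + v : l2) k * w k) =
    (fun n => a * (\sum_(0 <= k < n) u k * w k) + \sum_(0 <= k < n) v k * w k).
  apply/funext => n; rewrite mulr_sumr -big_split; apply: eq_bigr => k _.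
  by rewrite [LHS]mulrDl -mulrA.
by apply: cvgD; [apply: cvgM; first exact: cvg_cst|]; exact: l2_dot_cvg.
Qed.

Lemma l2_dot_ge (u : l2) n : \sum_(0 <= k < n) u k ^+ 2 <= l2_dot u u.
Proof.
apply: (@nondecreasing_cvgn_le _ (fun n => \sum_(0 <= k < n) u k ^+ 2)).
  apply/nondecreasing_seqP => m; rewrite big_nat_recr//= lerDl; exact: sqr_ge0.
exact: l2_sqr_cvg.
Qed.

Lemma l2_dot_le (u : l2) M :
  (forall n, \sum_(0 <= k < n) u k ^+ 2 <= M) -> l2_dot u u <= M.
Proof.
by move=> uM; apply: limr_le; [exact: l2_sqr_cvg|apply: nearW => n; exact: uM].
Qed.

Lemma l2_dot_ge0 (u : l2) : 0 <= l2_dot u u.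
Proof. by have := l2_dot_ge u 0; rewrite big_nil. Qed.

Lemma l2_dot_eq0 (u : l2) : l2_dot u u = 0 -> u = 0.
Proof.
move=> u0; apply/val_inj/funext => k /=.
have := l2_dot_ge u k.+1; rewrite u0 big_nat_recr//= => uk.
have : u k ^+ 2 <= 0.
  by apply: le_trans uk; rewrite lerDr sumr_ge0// => i _; exact: sqr_ge0.
by move=> uk0; apply/eqP; rewrite -sqrf_eq0 eq_le uk0 sqr_ge0.
Qed.

Fact l2_dot_bilinear : bilinear_for
  (GRing.Scale.Law.clone _ _ *%R _) (GRing.Scale.Law.clone _ _ (@idfun R \;
    *%R) _) l2_dot.
Proof.
split=> [w|w] a u v /=; first exact: l2_dotPl.
by rewrite ![l2_dot w _]l2_dotC l2_dotPl.
Qed.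

HB.instance Definition _ :=
  @bilinear_isBilinear.Build R l2 l2 R _ _ l2_dot l2_dot_bilinear.

Fact l2_dot_hermitian (u v : l2) :
  l2_dot u v = (-1) ^+ false * @idfun R (l2_dot v u).
Proof. by rewrite expr0 mul1r l2_dotC. Qed.

HB.instance Definition _ :=
  @isHermitianSesquilinear.Build R l2 false (@idfun R) l2_dot l2_dot_hermitian.

Fact l2_dot_gt0 (u : l2) : u != 0 -> 0 < l2_dot u u.
Proof.
move=> u0; rewrite lt_neqAle l2_dot_ge0 andbT eq_sym.
by apply: contra u0 => /eqP/l2_dot_eq0 ->.
Qed.

HB.instance Definition _ := @isDotProduct.Build R l2 l2_dot l2_dot_gt0.

Definition l2_norm (u : l2) : R := Num.sqrt (l2_dot u u).

Lemma l2_dot0l (v : l2) : l2_dot 0 v = 0.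
Proof. exact: linear0l. Qed.

Lemma l2_dotDl (u v w : l2) : l2_dot (u + v) w = l2_dot u w + l2_dot v w.
Proof. exact: linearDl. Qed.

Lemma l2_dotZl a (u v : l2) : l2_dot (a *: u) v = a * l2_dot u v.
Proof. exact: linearZl_LR. Qed.

Lemma l2_dotDD (u v : l2) :
  l2_dot (u + v) (u + v) = l2_dot u u + 2 * l2_dot u v + l2_dot v v.
Proof.
rewrite l2_dotDl ![l2_dot _ (u + v)]l2_dotC !l2_dotDl [l2_dot v u]l2_dotC.
by ring.
Qed.

Lemma l2_dotZZ a b (u v : l2) : l2_dot (a *: u) (b *: v) = a * b * l2_dot u v.
Proof. by rewrite l2_dotZl l2_dotC l2_dotZl l2_dotC mulrA. Qed.

(** Expand the square of [|v|^2 u - (u, v) v]. *)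
Lemma l2_cauchy_schwarz (u v : l2) : l2_dot u v <= l2_norm u * l2_norm v.
Proof.
have [v0|v0] := eqVneq (l2_dot v v) 0.
  by rewrite (l2_dot_eq0 v0) /l2_norm l2_dotC !l2_dot0l sqrtr0 mulr0.
have vv : 0 < l2_dot v v by rewrite lt_neqAle eq_sym v0 l2_dot_ge0.
rewrite /l2_norm -sqrtrM ?l2_dot_ge0//.
apply: le_trans (ler_norm _) _; rewrite -sqrtr_sqr ler_wsqrtr//.
have := l2_dot_ge0 (l2_dot v v *: u + (- l2_dot u v) *: v).
rewrite l2_dotDD !l2_dotZZ.
set a := l2_dot u v; set b := l2_dot v v; set c := l2_dot u u.
have -> : b * b * c + 2 * (b * - a * a) + - a * - a * b = b * (c * b - a ^+ 2) by ring.
by rewrite pmulr_rge0// subr_ge0.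
Qed.

Fact l2_normD (u v : l2) : l2_norm (u + v) <= l2_norm u + l2_norm v.
Proof.
rewrite -(ler_pXn2r (n := 2))// ?nnegrE ?addr_ge0 ?sqrtr_ge0//.
rewrite sqrrD /l2_norm !sqr_sqrtr ?l2_dot_ge0// l2_dotDD.
have := l2_cauchy_schwarz u v; rewrite /l2_norm; lra.
Qed.

Fact l2_normZ (a : R) (u : l2) : l2_norm (a *: u) = `|a| * l2_norm u.
Proof. by rewrite /l2_norm l2_dotZZ -expr2 sqrtrM ?sqr_ge0// sqrtr_sqr. Qed.

Fact l2_norm_eq0 (u : l2) : l2_norm u = 0 -> u = 0.
Proof.
move/eqP; rewrite sqrtr_eq0 => u0; apply: l2_dot_eq0.
by apply/eqP; rewrite eq_le u0 l2_dot_ge0.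
Qed.

HB.instance Definition _ :=
  @Lmodule_isNormed.Build R l2 l2_norm l2_normD l2_normZ l2_norm_eq0.

Lemma l2_norm_sqr (u : l2) : `|u| ^+ 2 = l2_dot u u.
Proof. by rewrite [ `|u| ]/(l2_norm u) sqr_sqrtr// l2_dot_ge0. Qed.

Lemma l2_coord_le (u : l2) k : `|u k| <= `|u|.
Proof.
rewrite -(ler_pXn2r (n := 2))// ?nnegrE// l2_norm_sqr real_normK ?num_real//.
apply: le_trans (l2_dot_ge u k.+1); rewrite big_nat_recr//= lerDr sumr_ge0// => i _.
exact: sqr_ge0.
Qed.

(** The coordinates of a Cauchy filter converge.  An [e]-ball around [u0] in
    the filter bounds the partial sums of the squares of [u0 - w], for the
    coordinatewise limit [w], by [e ^ 2]; so [w] is square summable and is the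
    limit in norm. *)
Lemma l2_complete (F : set_system l2) : ProperFilter F -> cauchy F -> cvg F.
Proof.
move=> FF Fc.
have Fe e : 0 < e -> exists u0 : l2, \forall u \near F, `|u0 - u| < e.
  move=> e0; have /cauchyP /(_ e e0)[u0 Fu0] := Fc.
  by exists u0; near=> u; have : ball u0 e u by near: u; exact: Fu0.
have cvF k : cvg ((fun u : l2 => u k) @ F).
  apply: cauchy_cvg; apply: cauchy_exP => e e0.
  have [u0 Fu0] := Fe e e0.
  exists (u0 k) => /=; near=> u.
  apply: le_lt_trans (l2_coord_le (u0 - u) k) _; near: u; exact: Fu0.
pose w k : R := lim ((fun u : l2 => u k) @ F).
have wle (u0 : l2) e : 0 < e -> (\forall u \near F, `|u0 - u| < e) ->
    forall n, \sum_(0 <= k < n) (u0 k - w k) ^+ 2 <= e ^+ 2.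
  move=> e0 Fu0 n.
  have cvn : (fun u : l2 => \sum_(0 <= k < n) (u0 k - u k) ^+ 2) @ F -->
      \sum_(0 <= k < n) (u0 k - w k) ^+ 2.
    elim: n => [|n IH].
      by rewrite big_nil; under eq_fun do rewrite big_nil; exact: cvg_cst.
    rewrite big_nat_recr//=; under eq_fun do rewrite big_nat_recr//=.
    apply: cvgD => //.
    have c1 : (fun u : l2 => u0 n - u n) @ F --> u0 n - w n.
      by apply: cvgB; [exact: cvg_cst|exact: cvF].
    exact: (cvgM c1 c1).
  rewrite -(cvg_lim _ cvn)//; apply: limr_le; first exact: cvgP cvn.
  near=> u; apply: le_trans (l2_dot_ge (u0 - u) n) _.
  rewrite -l2_norm_sqr ler_pXn2r ?nnegrE ?(ltW e0)//.
  by apply: ltW; near: u; exact: Fu0.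
have wP : w \in square_summable.
  have [u0 Fu0] := Fe 1 ltr01.
  have sw : (fun k => u0 k - w k) \in square_summable.
    by apply/square_summableP; exists (1 ^+ 2); exact: (wle u0).
  have -> : w = (u0 : nat -> R) - (fun k => u0 k - w k).
    by apply/funext => k; rewrite fctE subKr.
  by apply: rpredB => //; exact: l2P.
apply/cvg_ex; exists (L2 wP); apply/cvgrPdist_le => e e0.
have e2 : 0 < e / 2 by lra.
have [u0 Fu0] := Fe _ e2.
have le1 : `|u0 - L2 wP| <= e / 2.
  rewrite -(ler_pXn2r (n := 2))// ?nnegrE ?(ltW e2)// l2_norm_sqr.
  by apply: l2_dot_le => n; exact: wle.
near=> u.
have -> : L2 wP - u = (u0 - u) - (u0 - L2 wP) by rewrite opprB [RHS]addrC addrA subrK.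
apply: le_trans (ler_normB _ _) _.
have : `|u0 - u| < e / 2 by near: u; exact: Fu0.
lra.
Unshelve. all: by end_near. Qed.

HB.instance Definition _ := Uniform_isComplete.Build l2 l2_complete.

Lemma l2_hilbert : is_hilbert l2.
Proof. by exists l2_dot => u; rewrite l2_norm_sqr. Qed.

Lemma sqr_sum_nth_le (s : seq R) n :
  \sum_(0 <= k < n) s`_k ^+ 2 <= \sum_(x <- s) x ^+ 2.
Proof.
elim: s n => [|x s IH] [|n].
- by rewrite !big_nil.
- by rewrite big_nil big1// => k _; rewrite nth_nil expr0n.
- by rewrite big_nil sumr_ge0// => y _; exact: sqr_ge0.
- by rewrite big_nat_recl//= big_cons lerD2l.
Qed.

Lemma sqr_sum_nth_size (s : seq R) :
  \sum_(0 <= k < size s) s`_k ^+ 2 = \sum_(x <- s) x ^+ 2.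
Proof. by rewrite [RHS](big_nth 0). Qed.

Fact l2_of_seq_subproof (s : seq R) : nth 0 s \in square_summable.
Proof.
by apply/square_summableP; exists (\sum_(x <- s) x ^+ 2); exact: sqr_sum_nth_le.
Qed.

Definition l2_of_seq (s : seq R) : l2 := L2 (l2_of_seq_subproof s).

Lemma l2_norm_of_seq (s : seq R) : `|l2_of_seq s| ^+ 2 = \sum_(x <- s) x ^+ 2.
Proof.
rewrite l2_norm_sqr; apply/eqP; rewrite eq_le; apply/andP; split.
  apply: l2_dot_le => n; exact: sqr_sum_nth_le.
by rewrite -sqr_sum_nth_size; exact: (l2_dot_ge (l2_of_seq s)).
Qed.

Lemma l2_of_seq_map2 (I : Type) (r : seq I) (f g : I -> R) :
  l2_of_seq [seq f i | i <- r] - l2_of_seq [seq g i | i <- r] =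
  l2_of_seq [seq f i - g i | i <- r].
Proof.
apply/val_inj/funext => k.
have -> : val (l2_of_seq [seq f i | i <- r] - l2_of_seq [seq g i | i <- r]) k =
  [seq f i | i <- r]`_k - [seq g i | i <- r]`_k by [].
rewrite /=; elim: r k => [|x r IH] [|k] //=; first by rewrite subr0.
by rewrite subr0.
Qed.

End SquareSummable.

(** * Positive definite kernels *)

Section Gram.
Local Open Scope ring_scope.
Variable R : realType.

(** Kernels given by finitely many feature functions; these are exactly the
    positive definite kernels that come from a map to a space of finite
    dimension. *)
Definition gram (X : Type) (k : X -> X -> R) :=
  exists vs : seq (X -> R), forall x y, k x y = \sum_(v <- vs) v x * v y.

Lemma gram_rank1 (X : Type) (v : X -> R) : gram (fun x y => v x * v y).
Proof. by exists [:: v] => x y; rewrite big_seq1. Qed.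

Lemma gramD (X : Type) (k l : X -> X -> R) :
  gram k -> gram l -> gram (fun x y => k x y + l x y).
Proof. by move=> [u ku] [v lv]; exists (u ++ v) => x y; rewrite big_cat/= ku lv. Qed.

Lemma gramM (X : Type) (k l : X -> X -> R) :
  gram k -> gram l -> gram (fun x y => k x y * l x y).
Proof.
move=> [u ku] [v lv]; exists [seq (fun x => f x * g x) | f <- u, g <- v] => x y.
rewrite ku lv big_allpairs_dep/= mulr_suml; apply: eq_bigr => f _.
by rewrite mulr_sumr; apply: eq_bigr => g _; rewrite mulrACA.
Qed.

Lemma gram_sum (X J : Type) (s : seq J) (k : J -> X -> X -> R) :
  (forall j, gram (k j)) -> gram (fun x y => \sum_(j <- s) k j x y).
Proof.
move=> gk; elim: s => [|j s IH].
  by exists [::] => x y; rewrite !big_nil.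
have [u ju] := gk j; have [v sv] := IH; exists (u ++ v) => x y.
by rewrite big_cons ju sv big_cat.
Qed.

Lemma gram_comp (X Y : Type) (f : Y -> X) (k : X -> X -> R) :
  gram k -> gram (fun x y => k (f x) (f y)).
Proof.
by move=> [u ku]; exists [seq v \o f | v <- u] => x y; rewrite ku big_map.
Qed.

(** Averaging the feature functions of [k] with the weights [c] along the maps
    [h]. *)
Lemma gram_average (X Y J : Type) (s : seq J) (c : Y -> J -> R) (h : Y -> J -> X)
    (k : X -> X -> R) : gram k ->
  gram (fun x y => \sum_(i <- s) \sum_(j <- s) c x i * c y j * k (h x i) (h y j)).
Proof.
move=> [u ku]; exists [seq (fun y => \sum_(i <- s) c y i * v (h y i)) | v <- u] => x y.
rewrite big_map.
transitivity (\sum_(i <- s) \sum_(v <- u) \sum_(j <- s)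
    (c x i * v (h x i)) * (c y j * v (h y j))).
  apply: eq_bigr => i _; rewrite exchange_big; apply: eq_bigr => j _.
  by rewrite ku mulr_sumr; apply: eq_bigr => v _; rewrite mulrACA.
rewrite exchange_big; apply: eq_bigr => v _.
by rewrite mulr_suml; apply: eq_bigr => i _; rewrite mulr_sumr.
Qed.

(** A product over the coordinates [e] of kernels with the value 1 if
    the coordinates agree and [r] if they differ; each of them is
    [(1 + r) / 2 + (1 - r) / 2 * (-1) ^ (b x e) * (-1) ^ (b y e)]. *)
Lemma gram_pow_count (X E : Type) (r : R) (b : X -> E -> bool) (s : seq E) :
  0 <= r <= 1 -> gram (fun x y => r ^+ count (fun e => b x e (+) b y e) s).
Proof.
move=> /andP[r0 r1]; elim: s => [|e s IH].
  by exists [:: fun=> 1] => x y; rewrite big_seq1 expr0 mulr1.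
pose p := Num.sqrt ((1 + r) / 2); pose q := Num.sqrt ((1 - r) / 2).
have pp : p * p = (1 + r) / 2 by rewrite -expr2 sqr_sqrtr//; lra.
have qq : q * q = (1 - r) / 2 by rewrite -expr2 sqr_sqrtr//; lra.
have [u ku] := gramM (gramD (gram_rank1 (fun=> p)) (gram_rank1 (fun x =>
  q * (-1) ^+ b x e))) IH.
exists u => x y; rewrite -ku /= exprD; congr (_ * _); rewrite mulrACA pp qq.
by case: (b x e); case: (b y e); rewrite /= ?expr0 ?expr1; lra.
Qed.

End Gram.

(** * From kernels on the levels to an embedding of the box space *)

(** Bounds that are stable under enlargement can be chosen uniformly on a
    finite set. *)
Lemma bound_seq (T : eqType) (s : seq T) (P : T -> nat -> Prop) :
  (forall x m n, (m <= n) -> P x m -> P x n) ->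
  (forall x, x \in s -> exists n, P x n) ->
  exists n, forall x, x \in s -> P x n.
Proof.
move=> Pm; elim: s => [|x s IH] Ps; first by exists 0.
have [m Pxm] := Ps x (mem_head x s).
have [|n Psn] := IH; first by move=> y ys; apply: Ps; rewrite inE ys orbT.
exists (maxn m n) => y; rewrite inE => /orP[/eqP ->|/Psn].
  by apply: Pm Pxm; exact: leq_maxl.
by apply: Pm; exact: leq_maxr.
Qed.

Section CoarseEmbeddings.
Local Open Scope ring_scope.

Section CoarseOfProper.
Variables (R : realType) (X : metricType R) (H : completeNormedModType R).
Variables (f : X -> H) (L : R).
Hypotheses (L0 : 0 < L) (fL : forall x y, `|f x - f y| <= L * mdist x y).
Hypothesis f_proper :
  forall M : R, exists T : R, forall x y, T < mdist x y -> M <= `|f x - f y|.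

(** As lower control take the infimum over all pairs of the distance of the
    images plus the positive part of [t - mdist x y].  It is monotone in [t], it
    is at most the distance of the images when [t = mdist x y], and it is at
    least [M] once [t] exceeds [T + M], for [T] as in [f_proper]. *)
Lemma coarse_embedding_of_proper (x0 : X) :
  coarse_embedding mdist (fun u v : H => `|u - v|) f.
Proof.
pose D t : set R := [set r | exists x y, r = `|f x - f y| + Num.max 0 (t - mdist x y)].
have D0 t : lbound (D t) 0.
  by move=> _ [x [y ->]]; rewrite addr_ge0// le_max lexx.
have Dn t : D t !=set0 by exists (`|f x0 - f x0| + Num.max 0 (t - mdist x0 x0)), x0, x0.
have Dlb t : has_lbound (D t) by exists 0.
have Dinf t x y : inf (D t) <= `|f x - f y| + Num.max 0 (t - mdist x y).
  by apply: ge_inf => //; exists x, y.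
exists (fun t => inf (D t)), (fun t => L * t); split; first split.
- by move=> t t0; apply: lb_le_inf.
- move=> s t s0 st; apply: lb_le_inf => // _ [x [y ->]].
  apply: le_trans (Dinf s x y) _; rewrite lerD2l ge_max !le_max lexx/=.
  by rewrite lerD2r st orbT.
- apply/cvgryPge => M; have [T fT] := f_proper M.
  near=> t.
  have tTM : T + M <= t by near: t; apply: nbhs_pinfty_ge; rewrite num_real.
  apply: lb_le_inf => // _ [x [y ->]].
  have [dT|/fT Md] := leP (mdist x y) T; last first.
    by rewrite -[M]addr0 lerD// le_max lexx.
  rewrite -[M]add0r lerD//le_max; apply/orP; right.
  by lra.
- split.
  + by move=> t t0; rewrite mulr_ge0// ltW.
  + by move=> s t s0 st; rewrite ler_wpM2l// ltW.
  + apply/cvgryPge => M; near=> t.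
    have : L^-1 * M <= t by near: t; apply: nbhs_pinfty_ge; rewrite num_real.
    by rewrite ler_pdivrMl.
- move=> x y; rewrite fL andbT; apply: le_trans (Dinf _ x y) _.
  by rewrite subrr maxxx addr0.
Unshelve. all: by end_near. Qed.

End CoarseOfProper.

Lemma word_lipschitz (R : realType) (H : normedModType R) (Q : groupType) (S : seq Q)
    (gS : generates S) (f : Q -> H) (L : R) :
  (forall p s, s \in S -> `|f p - f (p * s)%g| <= L) ->
  forall p q, `|f p - f q| <= L * (word_dist gS p q)%:R.
Proof.
move=> fL p q; rewrite /word_dist;
  have [w /andP[Sw /eqP wpq] <-] := word_length_ex gS (p^-1 * q)%g.
have -> : q = (p * \prod_(x <- w) x)%g by rewrite wpq mulVKg.
elim: w Sw p {wpq} => [|a w IH] /=; first by move=> _ p;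
  rewrite big_nil mulg1 subrr normr0 mulr0.
move=> /andP[Sa Sw] p; rewrite big_cons mulgA -natr1 mulrDr mulr1 [leRHS]addrC.
have -> : f p - f (p * a * \prod_(x <- w) x)%g =
    (f p - f (p * a)%g) + (f (p * a)%g - f (p * a * \prod_(x <- w) x)%g).
  by rewrite addrA subrK.
apply: le_trans (ler_normD _ _) _; apply: lerD; last exact: IH.
move: Sa; rewrite mem_cat => /orP[|/mapP[s sS ->]]; first exact: fL.
by rewrite distrC -[X in _ - f X](mulgVK s p); exact: fL.
Qed.

Lemma finite_word_dist (Q : groupType) (S : seq Q) (gS : generates S) :
  finite_set [set: Q] -> exists n, forall p q, (word_dist gS p q <= n)%N.
Proof.
move=> /finite_seqP[s sE].
have ins p : p \in s by have : [set: Q] p by []; rewrite sE.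
have [|g _|n sn] := bound_seq (s := s) (P := fun g n => (word_length gS g <= n)%N).
- by move=> g m n mn gm; exact: leq_trans mn.
- by exists (word_length gS g).
- by exists n => p q; exact: sn.
Qed.

Section BoxEmbedding.
Variables (R : realType) (G : groupType) (S : seq G) (gS : generates S).
Variable K : nat -> normalSubgroup G.
Local Notation Q i := (quotientGroup (K i)).
Local Notation wd i := (word_dist (@generates_quotient _ _ gS (K i))).
Hypothesis K_finite : forall i, finite_index (K i).

(** A normalized positive definite kernel on one level that varies by at most
    [eps] along a generator and is at most 1/2 on pairs at distance more
    than [t]. *)
Definition kernel_at (eps : R) (t i : nat) (k : Q i -> Q i -> R) :=
  [/\ gram k, forall p, k p p = 1,
      forall p s, s \in S -> 1 - eps <= k p (p * coset (K i) s)%g &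
      forall p q, 1 / 2 < k p q -> (wd i p q <= t)%N].

Definition sqr_dist i (vs : seq (Q i -> R)) p q := \sum_(v <- vs) (v p - v q) ^+ 2.

(** The squared distance of the feature vectors is [2 - 2 * k p q]. *)
Lemma kernel_vectors eps t i k : @kernel_at eps t i k ->
  exists vs : seq (Q i -> R),
    (forall p s, s \in S -> sqr_dist vs p (p * coset (K i) s)%g <= 2 * eps) /\
    (forall p q, (t < wd i p q)%N -> 1 <= sqr_dist vs p q).
Proof.
move=> [[vs kvs] k1 keps kt]; exists vs.
have D p q : sqr_dist vs p q = 2 - 2 * k p q.
  transitivity (k p p + k q q - 2 * k p q); last by rewrite !k1.
  rewrite !kvs -big_split mulr_sumr -sumrB; apply: eq_bigr => v _ /=.
  by ring.
split=> [p s sS|p q tpq]; rewrite D; first by have := keps p s sS; lra.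
have [/kt|] := ltP (1 / 2) (k p q); last by lra.
by rewrite leqNgt tpq.
Qed.

Hypothesis kernels : forall eps : R, 0 < eps ->
  exists I t : nat, forall i, (I <= i)%N -> exists k, @kernel_at eps t i k.

Lemma sqr_dist_ge0 i (vs : seq (Q i -> R)) p q : 0 <= sqr_dist vs p q.
Proof. by apply: sumr_ge0 => v _; exact: sqr_ge0. Qed.

(** Level [i] receives the feature functions of the kernels of index [n < i]
    with error [2^-n / 2], as far as they exist on that level.  The sum of the
    errors is bounded.  Points of level [i] that are far apart are separated by
    each of the first [N] kernels, provided that [i] is large; the remaining
    finitely many levels are bounded. *)
Lemma level_vectors : exists vs : forall i, seq (Q i -> R),
  (forall i p s, s \in S -> sqr_dist (vs i) p (p * coset (K i) s)%g <= 2) /\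
  (forall N : nat, exists T : nat, forall i p q, (T < wd i p q)%N ->
     N%:R <= sqr_dist (vs i) p q).
Proof.
have ker n : {It : nat * nat | forall i, (It.1 <= i)%N ->
    exists vs : seq (Q i -> R),
    (forall p s, s \in S -> sqr_dist vs p (p * coset (K i) s)%g <= 2^-1 ^+ n) /\
    (forall p q, (It.2 < wd i p q)%N -> 1 <= sqr_dist vs p q)}.
  apply: cid; have [|I [t It]] := kernels (eps := 2^-1 ^+ n / 2).
    by rewrite divr_gt0// exprn_gt0.
  exists (I, t) => i /It[k /kernel_vectors[vs [vs1 vs2]]]; exists vs; split=> //.
  by move=> p s sS; apply: le_trans (vs1 p s sS) _; rewrite mulrC divfK.
pose I n := (projT1 (ker n)).1; pose t n := (projT1 (ker n)).2.
have vsn n i : {vs : seq (Q i -> R) |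
    (forall p s, s \in S -> sqr_dist vs p (p * coset (K i) s)%g <= 2^-1 ^+ n) /\
    ((I n <= i)%N -> forall p q, (t n < wd i p q)%N -> 1 <= sqr_dist vs p q)}.
  apply: cid; have [Ii|Ii] := leqP (I n) i.
    by have [vs [vs1 vs2]] := projT2 (ker n) i Ii; exists vs; split=> // _.
  exists [::]; split=> // p s sS; rewrite /sqr_dist big_nil exprn_ge0//.
pose vs i := flatten [seq projT1 (vsn n i) | n <- iota 0 i].
have vsE i p q : sqr_dist (vs i) p q =
    \sum_(0 <= n < i) sqr_dist (projT1 (vsn n i)) p q.
  by rewrite /sqr_dist big_flatten big_map /index_iota subn0.
exists vs; split=> [i p s sS|N].
  rewrite vsE; apply: (@le_trans _ _ (\sum_(0 <= n < i) 2^-1 ^+ n)).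
    by apply: ler_sum => n _; have [/(_ p s sS)] := projT2 (vsn n i).
  have : \sum_(0 <= n < i) (2^-1 : R) ^+ n = 2 - 2 * 2^-1 ^+ i.
    elim: i {p} => [|i IH]; first by rewrite big_nil expr0; lra.
    by rewrite big_nat_recr//= IH exprS; lra.
  move=> ->; rewrite gerBl mulr_ge0// exprn_ge0//.
(* from level [J] on, the first [N] kernels exist *)
pose J := (N + \sum_(0 <= n < N) I n)%N.
have JI n : (n < N)%N -> (I n <= J)%N.
  by move=> nN; rewrite /J big_mkord (bigD1 (Ordinal nN))//= addnCA leq_addr.
have [|i _|T0 T0P] := bound_seq (s := iota 0 J)
    (P := fun i n => forall p q, (wd i p q <= n)%N).
- by move=> i m n mn im p q; exact: leq_trans mn.
- by apply: finite_word_dist; exact: K_finite.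
exists (T0 + \sum_(0 <= n < N) t n)%N => i p q Tpq.
have Ji : (J <= i)%N.
  rewrite leqNgt; apply/negP => iJ; move: Tpq; apply/negP; rewrite -leqNgt.
  by apply: leq_trans (leq_addr _ _); apply: T0P; rewrite mem_iota.
have tn n : (n < N)%N -> (t n < wd i p q)%N.
  move=> nN; apply: leq_ltn_trans Tpq.
  by rewrite big_mkord (bigD1 (Ordinal nN))//= addnCA leq_addr.
have Ni : (N <= i)%N by apply: leq_trans Ji; exact: leq_addr.
rewrite vsE (big_cat_nat (leq0n N) Ni)/=.
rewrite -[N%:R]addr0 lerD//; last by apply: sumr_ge0 => n _; exact: sqr_dist_ge0.
have -> : N%:R = \sum_(0 <= n < N) 1 :> R by rewrite big_const_nat subn0 iter_addr_0.
apply: ler_sum_nat => n /andP[_ nN].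
have [_] := projT2 (vsn n i); apply; last exact: tn.
exact: leq_trans (JI n nN) Ji.
Qed.

Variable c : box_gaps R gS K.

Let P n : R := \sum_(0 <= k < n) c k.

Let P_mono m n : (m <= n)%N -> P m <= P n.
Proof.
move=> mn; rewrite /P (big_cat_nat (leq0n m) mn)//= lerDl sumr_ge0// => k _.
exact/ltW/gap_gt0.
Qed.

Let P_S n : P n.+1 = P n + c n.
Proof. by rewrite /P big_nat_recr. Qed.

Lemma level_dist_diam i (p q : Q i) : level_dist R gS p q <= level_diam R gS K i.
Proof.
have [n nP] := finite_word_dist (@generates_quotient _ _ gS (K i)) (K_finite i).
apply: ub_le_sup; last by exists p => //; exists q.
by exists n%:R => _ [x _ [y _ <-]]; rewrite ler_nat.
Qed.

(** The gaps next to the two levels exceed the diameters of these levels. *)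
Lemma level_gap i j (p : Q i) (q : Q j) : (i < j)%N ->
  level_dist R gS p 1%g <= P j - P i /\ level_dist R gS 1%g q <= P j - P i.
Proof.
move=> ij; split.
  apply: le_trans (level_dist_diam _ _) _.
  have := gap_gt c i; rewrite gt_max => /andP[/ltW ci _].
  apply: le_trans ci _; have := P_mono ij; rewrite P_S; lra.
apply: le_trans (level_dist_diam _ _) _; case: j ij q => // j ij q.
have := gap_gt c j; rewrite gt_max => /andP[_ /ltW cj].
apply: le_trans cj _; have : P i <= P j by exact: P_mono.
by rewrite P_S; lra.
Qed.

Lemma box_dist_lt i j (p : Q i) (q : Q j) : (i < j)%N ->
  box_dist gS c (existT _ i p) (existT _ j q) =
  level_dist R gS p 1%g + (P j - P i) + level_dist R gS 1%g q.
Proof.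
move=> ij; rewrite /box_dist /= ltn_eqF// (minn_idPl (ltnW ij)) (maxn_idPr (ltnW ij)).
by rewrite /P (big_cat_nat (leq0n i) (ltnW ij))//= [X in X - _]addrC addrK.
Qed.

(** The first coordinate of [f] is the sum [P i] of the gaps below level [i],
    the others are the feature functions, shifted to vanish at the identity.
    On distinct levels, [f] is Lipschitz because a path between them passes
    through the identities, and the first coordinate alone is at least a third
    of the distance by [level_gap]. *)
Theorem box_space_embeds : embeds_coarsely_in_Hilbert (box_space c).
Proof.
have [vs [vs1 vs2]] := level_vectors.
pose f (u : box_space c) : l2 R :=
  l2_of_seq (P (tag u) :: [seq v (tagged u) - v 1%g | v <- vs (tag u)]).
pose lv i (p : Q i) : box_space c := existT _ i p.
exists (l2 R), f; split; first exact: l2_hilbert.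
pose W i : seq (Q i -> R) := (fun=> P i) :: [seq (fun p => v p - v 1%g) | v <- vs i].
have fE i (p : Q i) : f (lv i p) = l2_of_seq [seq w p | w <- W i].
  by rewrite /W /= -map_comp.
have f_same i (p q : Q i) : `|f (lv i p) - f (lv i q)| ^+ 2 = sqr_dist (vs i) p q.
  rewrite !fE l2_of_seq_map2 l2_norm_of_seq big_map /W big_cons subrr expr0n add0r.
  by rewrite big_map; apply: eq_bigr => v _; rewrite opprB addrA subrK.
have f_lip i (p q : Q i) : `|f (lv i p) - f (lv i q)| <= 2 * level_dist R gS p q.
  apply: (word_lipschitz _ (f := fun p => f (lv i p))) => {}p s /mapP[t tS ->].
  rewrite -(ler_pXn2r (n := 2))// ?nnegrE// f_same.
  by apply: le_trans (vs1 i p t tS) _; lra.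
have f_one i : f (lv i 1%g) = l2_of_seq [:: P i].
  apply/val_inj/funext => k /=; case: k => [|k] //=.
  rewrite nth_nil; elim: (vs i) k => [|v w IH] [|k] //=; exact: subrr.
have f_base i j : `|f (lv i 1%g) - f (lv j 1%g)| = `|P i - P j|.
  rewrite !f_one -[LHS]ger0_norm// -!sqrtr_sqr.
  have := l2_of_seq_map2 [:: tt] (fun=> P i) (fun=> P j); rewrite /= => ->.
  by rewrite l2_norm_of_seq big_seq1.
have f_coord i j (p : Q i) (q : Q j) : `|P i - P j| <= `|f (lv i p) - f (lv j q)|.
  exact: (l2_coord_le (f (lv i p) - f (lv j q)) 0).
have P_dist i j : (i < j)%N -> `|P i - P j| = P j - P i.
  by move=> ij; rewrite distrC ger0_norm// subr_ge0; apply: P_mono; exact: ltnW.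
have f_lt_le i j (p : Q i) (q : Q j) : (i < j)%N ->
    `|f (lv i p) - f (lv j q)| <= 2 * box_dist gS c (lv i p) (lv j q).
  move=> ij; rewrite box_dist_lt//.
  have -> : f (lv i p) - f (lv j q) = (f (lv i p) - f (lv i 1%g)) +
      (f (lv i 1%g) - f (lv j 1%g)) + (f (lv j 1%g) - f (lv j q)).
    by rewrite !subrKA.
  apply: le_trans (ler_normD _ _) _.
  apply: le_trans (lerD (ler_normD _ _) (lexx _)) _.
  have := f_lip i p 1%g; have := f_lip j 1%g q; rewrite f_base P_dist//.
  have := P_mono (ltnW ij); lra.
have f_lt_ge i j (p : Q i) (q : Q j) : (i < j)%N ->
    box_dist gS c (lv i p) (lv j q) <= 3 * `|f (lv i p) - f (lv j q)|.
  move=> ij; rewrite box_dist_lt//; have [pP qP] := level_gap p q ij.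
  have := f_coord i j p q; rewrite P_dist//.
  lra.
apply: (@coarse_embedding_of_proper R (box_space c) (l2 R) f 2) => //.
- move=> [i p] [j q]; have [ij|ji|ij] := ltngtP i j; first exact: f_lt_le.
  + by rewrite distrC metric_sym; exact: f_lt_le.
  + by subst j; rewrite [mdist _ _]box_dist_same; exact: f_lip.
- move=> M; pose N := Num.bound (M ^+ 2).
  have [T TN] := vs2 N.
  exists (Num.max T%:R (3 * M)) => -[i p] [j q]; rewrite gt_max => /andP[Td Md].
  have [ij|ji|ij] := ltngtP i j.
  + have /(lt_le_trans Md) := f_lt_ge i j p q ij; rewrite ltr_pM2l//; exact: ltW.
  + rewrite distrC; have /(lt_le_trans _) := f_lt_ge j i q p ji.
    rewrite metric_sym in Md => /(_ _ Md); rewrite ltr_pM2l//; exact: ltW.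
  + subst j; move: Td; rewrite [mdist _ _]box_dist_same ltr_nat => /TN NM.
    apply: le_trans (ler_norm _) _.
    rewrite -(ler_pXn2r (n := 2))// ?nnegrE// f_same real_normK ?num_real//.
    apply: le_trans NM; exact/ltW/archi_boundP/sqr_ge0.
- exact: (lv 0%N 1%g).
Qed.

End BoxEmbedding.

End CoarseEmbeddings.

(** * Semidirect products *)

Section NormalIntersection.
Variables (G : groupType) (K L : normalSubgroup G).

Definition normalI : normalSubgroup G.
Proof.
apply: (@make_normal G (fun x => x \in K /\ x \in L)).
- by split; exact: gpred1.
- by move=> x y [xK xL] [yK yL]; split; exact: gpredM.
- by move=> x [xK xL]; rewrite !gpredV.
- by move=> x y [xK xL]; split; exact: nsub_conj.
Defined.

Lemma normalIP x : (x \in normalI) <-> (x \in K /\ x \in L).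
Proof. exact: make_normalP. Qed.

Lemma normalI_finite_index :
  finite_index K -> finite_index L -> finite_index normalI.
Proof.
move=> fK fL; apply: (@finite_index_fun _ _ _ (fun x => (coset K x, coset L x))).
  by apply: finite_range_pair; exact: finite_index_range.
by move=> x y [/cosetP xyK /cosetP xyL]; apply/normalIP.
Qed.

End NormalIntersection.

Section ResidualChain.
Variable G : groupType.

Lemma finitely_generated_enum : finitely_generated G ->
  exists e : nat -> G, forall g, exists n, e n = g.
Proof.
move=> [S gS]; pose T := S ++ [seq s^-1 | s <- S].
exists (fun n => \prod_(l <- odflt [::] (choice.unpickle n : option (seq nat))) nth 1 T
  l) => g.
have [w /andP[Sw /eqP <-]] := gS g.
exists (choice.pickle [seq index a T | a <- w]); rewrite choice.pickleK /= big_map.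
by apply: eq_big_seq => a aw; rewrite nth_index//; exact: (allP Sw).
Qed.

(** Enumerate the group and intersect, one after the other, subgroups of finite
    index that exclude its nontrivial elements. *)
Lemma residual_chain : finitely_generated G -> residually_finite G ->
  exists P : nat -> normalSubgroup G,
    [/\ forall i, {subset P i.+1 <= P i}, forall i, finite_index (P i)
      & forall g, (forall i, g \in P i) -> g = 1].
Proof.
move=> /finitely_generated_enum[e eG] rfG.
have sep g : {N : normalSubgroup G | finite_index N /\ (g <> 1 -> g \notin N)}.
  apply: cid; have [->|g1] := pselect (g = 1); last first.
    by have [N [fN gN]] := rfG g g1; exists N.
  by exists (whole_group G); split=> //; exact: whole_group_finite_index.
pose fix P i := if i is j.+1 then normalI (P j) (projT1 (sep (e j))) else whole_group G.
exists P; split=> [i x /normalIP[]//||g gP].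
  elim=> [|i IH] /=; first exact: whole_group_finite_index.
  by apply: normalI_finite_index => //; case: (projT2 (sep (e i))).
have [j ej] := eG g; have [//|g1] := pselect (g = 1).
have /normalIP[_] := gP j.+1; have [_] := projT2 (sep (e j)).
by rewrite ej => /(_ g1)/negPf ->.
Qed.

End ResidualChain.

Section SemidirectProduct.
Variables (F G Gamma : groupType).
Variables (iota : {multiplicative F -> Gamma}) (sigma : {multiplicative G -> Gamma}).
Hypothesis sdp : semidirect_product iota sigma.

Let iota_inj : injective iota. Proof. by case: sdp. Qed.
Let sigma_inj : injective sigma. Proof. by case: sdp. Qed.

Lemma conj_iota_subproof a x : {y | iota y = iota x ^ sigma a}.
Proof.
by apply: cid; case: sdp => _ _ /(_ x (sigma a))[y xy] _ _; exists y.
Qed.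

(** The automorphism of [F] induced by conjugation by [sigma a]; as
    [x ^ y = y^-1 * x * y], this is a right action. *)
Definition act (a : G) (x : F) : F := projT1 (conj_iota_subproof a x).

Lemma iota_act a x : iota (act a x) = iota x ^ sigma a.
Proof. exact: projT2 (conj_iota_subproof a x). Qed.

Lemma act_morph a : {morph act a : x y / x * y}.
Proof. by move=> x y; apply: iota_inj; rewrite gmulfM !iota_act gmulfM conjMg. Qed.

Lemma actM a b x : act (a * b) x = act b (act a x).
Proof. by apply: iota_inj; rewrite !iota_act gmulfM conjgM. Qed.

Lemma act1 x : act 1 x = x.
Proof. by apply: iota_inj; rewrite iota_act (morph1 (@gmulfM _ _ sigma)) conjg1. Qed.

Lemma actK a x : act a (act a^-1 x) = x.
Proof. by rewrite -actM mulVg act1. Qed.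

Lemma semidirect_decomp_subproof g : {p : G * F | g = sigma p.1 * iota p.2}.
Proof.
apply: cid; case: sdp => _ _ _ _ /(_ g)[x [q ->]].
by exists (q, act q x); rewrite /= iota_act conjgC.
Qed.

(** The parts [a] of [G] and [x] of [F] in [g = sigma a * iota x]. *)
Definition gpart (g : Gamma) : G := (projT1 (semidirect_decomp_subproof g)).1.
Definition fpart (g : Gamma) : F := (projT1 (semidirect_decomp_subproof g)).2.

Lemma semidirectE g : g = sigma (gpart g) * iota (fpart g).
Proof. exact: projT2 (semidirect_decomp_subproof g). Qed.

Lemma semidirect_uniq q x g : g = sigma q * iota x -> gpart g = q /\ fpart g = x.
Proof.
rewrite {1}(semidirectE g) => E.
have E1 : iota (fpart g * x^-1) = sigma ((gpart g)^-1 * q).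
  rewrite !gmulfM (morphV (@gmulfM _ _ iota)) (morphV (@gmulfM _ _ sigma)).
  apply: (@mulIg _ (iota x)); rewrite mulgVK -mulgA -E.
  by rewrite mulKg.
have /[dup] E2 : iota (fpart g * x^-1) = 1 by case: sdp => _ _ _ + _; apply; exact: E1.
rewrite -(morph1 (@gmulfM _ _ iota)) => /iota_inj/divg1_eq ->.
by move: E2; rewrite E1 -(morph1 (@gmulfM _ _ sigma)) => /sigma_inj/mulg1_eq;
  rewrite invgK.
Qed.

Lemma semidirectM g h : gpart (g * h) = gpart g * gpart h /\
  fpart (g * h) = act (gpart h) (fpart g) * fpart h.
Proof.
apply: semidirect_uniq; rewrite {1}(semidirectE g) {1}(semidirectE h).
rewrite !gmulfM iota_act -!mulgA; congr (_ * _).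
by rewrite mulVKg.
Qed.

Lemma gpartM g h : gpart (g * h) = gpart g * gpart h.
Proof. exact: (semidirectM g h).1. Qed.

Lemma fpartM g h : fpart (g * h) = act (gpart h) (fpart g) * fpart h.
Proof. exact: (semidirectM g h).2. Qed.

Lemma gpart_sigma q : gpart (sigma q) = q.
Proof.
have [|-> //] := @semidirect_uniq q 1 (sigma q).
by rewrite (morph1 (@gmulfM _ _ iota)) mulg1.
Qed.

Lemma fpart_sigma q : fpart (sigma q) = 1.
Proof.
have [|_ -> //] := @semidirect_uniq q 1 (sigma q).
by rewrite (morph1 (@gmulfM _ _ iota)) mulg1.
Qed.

Lemma gpart_iota x : gpart (iota x) = 1.
Proof.
have [|-> //] := @semidirect_uniq 1 x (iota x).
by rewrite (morph1 (@gmulfM _ _ sigma)) mul1g.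
Qed.

Lemma fpart_iota x : fpart (iota x) = x.
Proof.
have [|_ -> //] := @semidirect_uniq 1 x (iota x).
by rewrite (morph1 (@gmulfM _ _ sigma)) mul1g.
Qed.

Lemma gpartV g : gpart g^-1 = (gpart g)^-1.
Proof. exact: (morphV gpartM). Qed.

Lemma fpart1 : fpart 1 = 1.
Proof. by rewrite -(morph1 (@gmulfM _ _ iota)) fpart_iota. Qed.

Lemma fpartV g : fpart g^-1 = (act (gpart g)^-1 (fpart g))^-1.
Proof.
apply: (@mulgI _ (act (gpart g)^-1 (fpart g))); rewrite mulgV -gpartV -fpartM mulgV.
exact: fpart1.
Qed.

Section ActionKernel.
Variable N : normalSubgroup F.
Hypothesis N_act : forall a x, x \in N -> act a x \in N.

Definition acts_trivially a := forall x, x^-1 * act a x \in N.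

Fact acts_trivially1 : acts_trivially 1.
Proof. by move=> x; rewrite act1 mulVg gpred1. Qed.

Fact acts_triviallyM a b : acts_trivially a -> acts_trivially b ->
  acts_trivially (a * b).
Proof.
move=> ta tb x; rewrite actM -(mulVKg (act a x) (act b _)) mulgA.
by apply: gpredM; [exact: ta|exact: tb].
Qed.

Fact acts_triviallyV a : acts_trivially a -> acts_trivially a^-1.
Proof.
by move=> /[swap] x /(_ (act a^-1 x)); rewrite actK -gpredV invgM invgK.
Qed.

Fact acts_triviallyJ a b : acts_trivially a -> acts_trivially (a ^ b).
Proof.
move=> ta x; rewrite conjgE !actM.
have := N_act b (ta (act b^-1 x)).
by rewrite act_morph (morphV (@act_morph b)) actK.
Qed.

Definition action_kernel : normalSubgroup G :=
  make_normal acts_trivially1 acts_triviallyM acts_triviallyV acts_triviallyJ.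

Lemma action_kernelP a : (a \in action_kernel) <-> acts_trivially a.
Proof. exact: make_normalP. Qed.

(** The action of an element on [F / N] is determined by the images of finitely
    many generators. *)
Lemma action_kernel_finite_index : finitely_generated F ->
  finite_index N -> finite_index action_kernel.
Proof.
move=> [B gB] fN.
apply: (@finite_index_fun _ _ _ (fun a => [seq coset N (act a s) | s <- B])).
  by apply: finite_range_map => s; apply: sub_finite_set fN.
move=> a b /eq_in_map ab; apply/action_kernelP => x.
have E : forall y, coset N (act a y) = coset N (act b y).
  apply: (generates_ind gB) => [|y z ay az|y ay|s /ab//].
  - by rewrite !(morph1 (@act_morph _)).
  - by rewrite !act_morph !cosetM ay az.
  - by rewrite !(morphV (@act_morph _)) !cosetV ay.
by have /cosetP := E (act a^-1 x); rewrite actK -actM.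
Qed.

End ActionKernel.

Section Extension.
Variables (N : normalSubgroup F) (M : normalSubgroup G).
Hypothesis N_act : forall a x, x \in N -> act a x \in N.
Hypothesis M_triv : forall m, m \in M -> forall x, x^-1 * act m x \in N.

(** Membership in the subgroup [N M] of [Gamma]. *)
Definition in_extension g := gpart g \in M /\ fpart g \in N.

Fact in_extension1 : in_extension 1.
Proof. by rewrite /in_extension (morph1 gpartM) fpart1; split; exact: gpred1. Qed.

Fact in_extensionM g h : in_extension g -> in_extension h -> in_extension (g * h).
Proof.
move=> [gM gN] [hM hN]; rewrite /in_extension gpartM fpartM.
by split; apply: gpredM => //; exact: N_act.
Qed.

Fact in_extensionV g : in_extension g -> in_extension g^-1.
Proof.
by move=> [gM gN]; rewrite /in_extension gpartV fpartV !gpredV; split=> //;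
  exact: N_act.
Qed.

Lemma coset_act m x : m \in M -> coset N (act m x) = coset N x.
Proof. by move=> mM; apply/esym/cosetP; exact: M_triv. Qed.

(** Thus [Gamma / (N M)] is the product of [G / M] and [F / N] as a set. *)
Lemma in_extension_eq g h : coset M (gpart g) = coset M (gpart h) ->
  coset N (fpart g) = coset N (fpart h) -> in_extension (g^-1 * h).
Proof.
move=> gh1 gh2; rewrite /in_extension gpartM fpartM gpartV fpartV; split;
  first exact/cosetP.
apply/coset_eq1; rewrite (morphV (@act_morph _)) -actM cosetM cosetV.
by rewrite coset_act; [rewrite gh2 mulVg|exact/cosetP].
Qed.

Fact in_extensionJ g h : in_extension g -> in_extension (g ^ h).
Proof.
move=> [gM gN]; rewrite conjgE; apply: in_extension_eq; rewrite ?gpartM ?fpartM.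
  by have /coset_eq1 g1 := gM; rewrite cosetM g1 mul1g.
by have /coset_eq1 g1 := N_act (gpart h) gN; rewrite cosetM g1 mul1g.
Qed.

Definition extension : normalSubgroup Gamma :=
  make_normal in_extension1 in_extensionM in_extensionV in_extensionJ.

Lemma extensionP g : (g \in extension) <-> in_extension g.
Proof. exact: make_normalP. Qed.

Lemma extension_finite_index :
  finite_index N -> finite_index M -> finite_index extension.
Proof.
move=> fN fM.
apply: (@finite_index_fun _ _ _ (fun g => (coset M (gpart g), coset N (fpart g)))).
  by apply: finite_range_pair; [move: fM|move: fN]; exact: sub_finite_set.
by move=> g h [gh1 gh2]; apply/extensionP; exact: in_extension_eq.
Qed.

End Extension.

End SemidirectProduct.

(** * Averaging a kernel over a finite subset of the complement *)

Section Kernel.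

Variables (R : realType) (F G Gamma : groupType).
Variables (iota : {multiplicative F -> Gamma}) (sigma : {multiplicative G -> Gamma}).
Hypothesis sdp : semidirect_product iota sigma.
Variables (B : seq F) (fB : free_basis [set` B]) (gB : generates B).
Variables (N : normalSubgroup F) (Es : seq (quotientGroup N * F)).
Hypotheses (uEs : uniq Es) (mEs : forall e, (e \in Es) = (e.2 \in B)).
Variable M : normalSubgroup G.
Local Notation N' := (homology_subgroup N).
Local Notation act := (act sdp).
Local Notation gpart := (gpart sdp).
Local Notation fpart := (fpart sdp).
Hypothesis N_act : forall a x, x \in N' -> act a x \in N'.
Hypothesis M_triv : forall m, m \in M -> forall x, x^-1 * act m x \in N'.
Hypothesis M_finite : finite_index M.
Variable A : seq G.
Hypotheses (uA : uniq A) (A0 : (0 < size A)%N) (A_inj : {in A &, injective (coset M)}).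
Variable r : R.
Hypothesis r01 : (0 <= r <= 1)%R.
Local Notation dist := (chain_dist fB Es).
Local Notation ext := (extension N_act M_triv).

(** The points [g * sigma a] and [h * sigma b] are compared when they lie in the
    same coset of [F] modulo [M]; their [F]-parts are [act a (fpart g)] and
    [act b (fpart h)]. *)
Definition average_term (g h : Gamma) (a b : G) : R :=
  ((coset M (gpart g * a) == coset M (gpart h * b))%:R
    * r ^+ dist (act a (fpart g)) (act b (fpart h)))%R.

Definition average_kernel (g h : Gamma) : R :=
  ((size A)%:R^-1 * \sum_(a <- A) \sum_(b <- A) average_term g h a b)%R.

Lemma path_chain_mod x y e : x^-1 * y \in N' ->
  path_chain fB x e = @path_chain _ _ fB N y e.
Proof.
move=> xyN; rewrite -[y in RHS](mulVKg x) path_chainM /translate.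
by rewrite (homology_subgroup_chain fB _ xyN) addbF.
Qed.

Lemma average_term_ge0 g h a b : (0 <= average_term g h a b)%R.
Proof.
have /andP[r0 _] := r01.
by rewrite /average_term mulr_ge0// exprn_ge0.
Qed.

Lemma average_term_eq g h a b : coset M (gpart g * a) = coset M (gpart h * b) ->
  average_term g h a b = (r ^+ dist (act a (fpart g)) (act b (fpart h)))%R.
Proof. by move=> gh; rewrite /average_term gh eqxx mul1r. Qed.

Lemma average_term_neq g h a b : coset M (gpart g * a) != coset M (gpart h * b) ->
  average_term g h a b = 0%R.
Proof. by move=> /negPf gh; rewrite /average_term gh mul0r. Qed.

(** The coincidence of two cosets is a sum over all cosets [w] of products of
    two indicators, so the kernel is a sum over [w] of averages of [r ^ dist]. *)
Lemma average_kernel_gram : gram average_kernel.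
Proof.
have /finite_seqP[Ms0 Ms0E] := M_finite.
pose Ms := undup Ms0.
have MsE v : v \in Ms by rewrite mem_undup; have : [set: quotientGroup M] v by [];
  rewrite Ms0E.
have gk : gram (fun x y => r ^+ dist x y)%R.
  by have := gram_pow_count (X := F) (path_chain fB (N := N)) Es r01.
have [vs vsE] := gramM (gram_rank1 (fun _ : Gamma => Num.sqrt ((size A)%:R^-1 : R)))
  (gram_sum Ms (fun w => gram_average A
    (fun (g : Gamma) a => (coset M (gpart g * a) == w)%:R%R)
    (fun (g : Gamma) a => act a (fpart g)) gk)).
exists vs => g h; rewrite -vsE -expr2 sqr_sqrtr ?invr_ge0//; congr (_ * _)%R.
rewrite [RHS]exchange_big; apply: eq_bigr => a _; rewrite [RHS]exchange_big;
  apply: eq_bigr => b _.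
rewrite -mulr_suml; congr (_ * _)%R.
rewrite (bigD1_seq (coset M (gpart g * a))) ?undup_uniq//= eqxx mul1r.
rewrite big1 ?addr0 1?eq_sym// => w /negPf gw.
by rewrite eq_sym gw mul0r.
Qed.

(** As [A] injects into [G / M], only the diagonal terms survive. *)
Lemma average_kernel1 g : average_kernel g g = 1%R.
Proof.
rewrite /average_kernel.
have -> : (\sum_(a <- A) \sum_(b <- A) average_term g g a b = \sum_(a <- A) 1)%R.
  apply: eq_big_seq => a aA; rewrite (bigD1_seq a)//= average_term_eq//.
  rewrite /chain_dist (eq_count (a2 := pred0)) ?count_pred0 ?expr0; last first.
    by move=> e; rewrite /= addbb.
  rewrite big1_seq ?addr0// => b /andP[ba bA]; apply: average_term_neq.
  apply: contra ba => /eqP; rewrite !cosetM => /mulgI abM.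
  by rewrite eq_sym; apply/eqP; exact: A_inj.
rewrite big_const_seq count_predT iter_addr_0 mulVf// pnatr_eq0 -lt0n//.
Qed.

(** The kernel lives on the quotient by the extension of [M] by [N']. *)
Lemma average_kernel_modr g h k : k \in ext ->
  average_kernel g (h * k) = average_kernel g h.
Proof.
move=> /extensionP[kM kN]; congr (_ * _)%R; apply: eq_bigr => a _;
  apply: eq_bigr => b _.
have ckM := (coset_eq1 M (gpart k)).2 kM.
rewrite /average_term gpartM fpartM !cosetM ckM mulg1; congr (_ * _ ^+ _)%R.
apply: eq_count => e /=; congr addb; apply: path_chain_mod.
apply/cosetP; rewrite act_morph cosetM.
rewrite [X in _ * X](coset_eq1 _ _).2 ?mulg1; last exact: N_act.
apply/cosetP; rewrite -(morphV (act_morph sdp b)) -act_morph; apply: N_act.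
by rewrite -gpredV invgM invgK; exact: M_triv.
Qed.

(** As [A] injects into [G / M], there are at most as many nonzero terms as
    elements of [A], so one of them exceeds the average. *)
Lemma average_kernel_far g h : (1 / 2 < average_kernel g h)%R ->
  exists a b, [/\ a \in A, b \in A, coset M (gpart g * a) = coset M (gpart h * b)
    & (1 / 2 < r ^+ dist (act a (fpart g)) (act b (fpart h)))%R].
Proof.
move=> gh; apply: contrapT => none; move: gh; apply/negP; rewrite -leNgt.
have le a b : a \in A -> b \in A -> (average_term g h a b <= 1 / 2)%R.
  move=> aA bA; have [E|E] := eqVneq (coset M (gpart g * a)) (coset M (gpart h * b)).
    rewrite average_term_eq// leNgt; apply/negP => lt; apply: none.
    by exists a, b.
  by rewrite average_term_neq//; lra.
rewrite /average_kernel ler_pdivrMl ?ltr0n//.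
have -> : ((size A)%:R * (1 / 2) = \sum_(a <- A) (1 / 2 : R))%R.
  by rewrite big_const_seq count_predT iter_addr_0 mulr_natl.
rewrite big_seq [leRHS]big_seq; apply: ler_sum => a aA.
have [/hasP[b bA /eqP ab]|/hasPn nab] :=
    boolP (has (fun b => coset M (gpart g * a) == coset M (gpart h * b)) A).
  rewrite (bigD1_seq b)//= big1_seq ?addr0; first exact: le.
  move=> b' /andP[bb' b'A]; apply: average_term_neq; apply: contra bb' => /eqP.
  rewrite ab !cosetM => /mulgI E; rewrite eq_sym; apply/eqP; exact: A_inj.
rewrite big1_seq; first by lra.
by move=> b /andP[_ bA]; apply: average_term_neq; exact: nab.
Qed.

(** The points [g * sigma (gpart s * b)] and [g * s * sigma b] lie in the same
    coset of [F], and their [F]-parts differ by [act b (fpart s)]; keep only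
    these terms. *)
Lemma average_kernel_near g s L : (forall a, a \in A ->
  word_ball B L (act a (fpart s))) ->
  ((count (fun a => (gpart s * a)%g \in A) A)%:R / (size A)%:R * r ^+ L
    <= average_kernel g (g * s)%g)%R.
Proof.
move=> sL; have /andP[r0 r1] := r01.
rewrite /average_kernel mulrAC mulrC; apply: ler_wpM2l; first by rewrite invr_ge0.
rewrite exchange_big/= -sum1_count natr_sum mulr_suml big_mkcond/=.
rewrite big_seq [leRHS]big_seq; apply: ler_sum => b bA.
case: ifPn => saA; last by apply: sumr_ge0 => a _; exact: average_term_ge0.
rewrite (bigD1_seq (gpart s * b))//=.
rewrite -[leLHS]addr0; apply: lerD; last first.
  by apply: sumr_ge0 => a _; exact: average_term_ge0.
rewrite average_term_eq ?gpartM ?mulgA// mul1r.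
apply: ler_wiXn2l => //; rewrite fpartM act_morph -actM.
have [w [Bw wL ->]] := sL b bA.
exact: leq_trans (chain_dist_word fB uEs mEs _ Bw) wL.
Qed.

End Kernel.

(** * Choice of the subgroups and proof of the theorem *)

Section WordLength.
Variables (G : groupType) (S : seq G) (gS : generates S).

Lemma word_length_coset (K : normalSubgroup G) g :
  word_length (@generates_quotient _ _ gS K) (coset K g) <= word_length gS g.
Proof.
have [w /andP[Sw /eqP <-] <-] := word_length_ex gS g.
rewrite -(size_map (coset K)); apply: word_length_le; apply/andP; split.
  apply/allP => _ /mapP[t tw ->].
  have := allP Sw _ tw; rewrite /= !mem_cat => /orP[tS|/mapP[s sS ->]].
    by rewrite map_f.
  by apply/orP; right; rewrite cosetV; do 2!apply: map_f.
apply/eqP; elim: w {Sw} => [|a w IH]; first by rewrite !big_nil.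
by rewrite /= !big_cons cosetM IH.
Qed.

Lemma word_length_ball (F : groupType) (f : {multiplicative F -> G}) (B : seq F) C n x :
  (forall s, s \in B -> word_length gS (f s) <= C) -> word_ball B n x ->
  word_length gS (f x) <= n * C.
Proof.
move=> BC [w [Bw wn ->]]; apply: (@leq_trans (size w * C));
  last by rewrite leq_mul2r wn orbT.
elim: w Bw {wn} => [|[s c] w IH] /=.
  by rewrite /word_val big_nil (morph1 (@gmulfM _ _ f)) word_length1.
move=> /andP[/= /BC sC /IH wC]; rewrite word_val_cons gmulfM mulSn.
apply: leq_trans (word_lengthM _ _ _) _; apply: leq_add => //.
by rewrite /letter /=; case: c; rewrite // (morphV (@gmulfM _ _ f)) word_lengthV.
Qed.

End WordLength.

Section PowerBounds.
Local Open Scope ring_scope.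
Variables (R : realType) (h : R).
Hypothesis h0 : 0 < h.

Lemma inv1D_bounds : 0 <= (1 + h)^-1 <= 1.
Proof. by rewrite invr_ge0 invf_le1 ?addr_ge0 ?lerDl ?ltW// ltr_wpDl. Qed.

(** Parameters [(1 + h)^-1] close to 1 keep a given power above [1 - d]. *)
Lemma inv1D_pow_ge n : 1 - n%:R * h <= (1 + h)^-1 ^+ n.
Proof.
have /andP[r0 r1] := inv1D_bounds.
elim: n => [|n IH]; first by rewrite mul0r subr0 expr0.
set x := _ ^+ n.+1.
have xh : x * h <= h by rewrite ger_pMl//; exact: exprn_ile1.
have xE : (1 + h)^-1 ^+ n = x * (1 + h).
  by rewrite /x exprSr divfK// gt_eqF// ltr_wpDl.
by move: IH; rewrite xE mulrDr mulr1 -natr1 mulrDl mul1r; lra.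
Qed.

Lemma inv1D_pow_small : exists m, forall n, 1 / 2 < (1 + h)^-1 ^+ n -> (n <= m)%N.
Proof.
have /andP[r0 r1] := inv1D_bounds.
have bern n : 1 + n%:R * h <= (1 + h) ^+ n.
  elim: n => [|n IH]; first by rewrite mul0r addr0 expr0.
  have y1 : 1 <= (1 + h) ^+ n by rewrite exprn_ege1// lerDl ltW.
  have hy : h <= h * (1 + h) ^+ n by rewrite ler_pMr.
  by rewrite exprS -natr1 [leRHS]mulrDl mul1r mulrDl mul1r addrA; apply: lerD.
exists (Num.bound h^-1) => n; apply: contraTT; rewrite -ltnNge -leNgt => mn.
apply: le_trans (ler_wiXn2l r0 r1 (ltnW mn)) _.
have := bern (Num.bound h^-1); have : h^-1 < (Num.bound h^-1)%:R.
  by apply: archi_boundP; rewrite invr_ge0 ltW.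
rewrite exprVn -[_ < _](ltr_pM2r h0) mulVf ?gt_eqF// => b1 b2.
have h1 : 0 < 1 + h by rewrite addr_gt0.
rewrite div1r lef_pV2// ?posrE ?exprn_gt0//.
by apply: le_trans b2; rewrite (_ : 2 = 1 + 1)// lerD2l ltW.
Qed.

End PowerBounds.

Section Folner.
Local Open Scope fset_scope.
Variables (R : realType) (G : groupType).

(** The elements of [A] that [g] moves out of [A] inject into [g A - A]. *)
Lemma folner_count (A : {fset G}) (g : G) (d : R) :
  let gA := [fset (g * a)%g | a in A] in
  ((#|` (gA `\` A) `|` (A `\` gA)|)%:R <= d * (#|` A|)%:R)%R -> A != fset0 ->
  (1 - d <= (count (fun a => (g * a)%g \in A) A)%:R / (size A)%:R)%R.
Proof.
move=> gA gAd A0; have sA : (0 < (size A)%:R :> R)%R by rewrite ltr0n cardfs_gt0.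
rewrite ler_pdivlMr// mulrBl mul1r lerBlDl.
apply: (@le_trans _ _ ((count (predC (fun a => (g * a)%g \in A)) A)%:R +
    (count (fun a => (g * a)%g \in A) A)%:R)%R).
  by rewrite -natrD addnC count_predC.
rewrite lerD2r; apply: le_trans gAd;
  rewrite ler_nat -size_filter -(size_map (fun a => (g * a)%g)).
apply: uniq_leq_size.
  rewrite map_inj_uniq; last exact: mulgI.
  by apply: filter_uniq; exact: fset_uniq.
move=> _ /mapP[a + ->]; rewrite mem_filter /= => /andP[gaA aA].
by rewrite in_fsetU !in_fsetD gaA; apply/orP; left; apply/imfsetP; exists a.
Qed.

End Folner.

Lemma word_ball_le (F : groupType) (B : seq F) m n x :
  m <= n -> word_ball B m x -> word_ball B n x.
Proof. by move=> mn [w [Bw wm ->]]; exists w; split=> //; exact: leq_trans mn. Qed.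

Section Main.
Variables (R : realType) (F G Gamma : groupType).
Variables (iota : {multiplicative F -> Gamma}) (sigma : {multiplicative G -> Gamma}).
Hypotheses (fgF : finitely_generated F) (amenG : amenable R G).
Hypothesis sdp : semidirect_product iota sigma.
Variables (S : seq Gamma) (gS : generates S).
Variables (B : seq F) (fB : free_basis [set` B]) (gB : generates B).
Variable P : nat -> normalSubgroup G.
Hypothesis P_sub : forall i, {subset P i.+1 <= P i}.
Hypothesis P_finite : forall i, finite_index (P i).
Hypothesis P_trivial : forall g, (forall i, g \in P i) -> g = 1.
Local Notation act := (act sdp).
Local Notation gpart := (gpart sdp).
Local Notation fpart := (fpart sdp).
Local Notation N i := (homology_tower F i).

Lemma tower_act i a x : x \in N i -> act a x \in N i.
Proof. by apply: homology_tower_endo; exact: act_morph. Qed.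

Definition complement_chain i : normalSubgroup G :=
  normalI (P i) (action_kernel (@tower_act i.+1)).

Lemma complement_chain_triv i m : m \in complement_chain i ->
  forall x, x^-1 * act m x \in N i.+1.
Proof. by move=> /normalIP[_ /action_kernelP]. Qed.

Lemma complement_chain_sub i j : i <= j ->
  {subset complement_chain j <= complement_chain i}.
Proof.
move=> /subnK <-; elim: (j - i)%N => [//|k IH] a;
  rewrite addSn => /normalIP[aP /action_kernelP aN].
apply: IH; apply/normalIP; split; first exact: P_sub.
apply/action_kernelP => x; exact: homology_subgroup_sub (aN x).
Qed.

Lemma complement_chain_finite_index i : finite_index (complement_chain i).
Proof.
apply: normalI_finite_index; first exact: P_finite.
by apply: action_kernel_finite_index => //; exact: (homology_tower_finite_index fB gB).
Qed.

Definition box_subgroup i : normalSubgroup Gamma :=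
  extension (@tower_act i.+1) (@complement_chain_triv i).

Lemma box_subgroup_sub i : {subset box_subgroup i.+1 <= box_subgroup i}.
Proof.
move=> g /extensionP[gM gN]; apply/extensionP; split.
  exact: complement_chain_sub (leqnSn i) _ gM.
exact: homology_subgroup_sub gN.
Qed.

Lemma box_subgroup_finite_index i : finite_index (box_subgroup i).
Proof.
apply: extension_finite_index; first exact: (homology_tower_finite_index fB gB).
exact: complement_chain_finite_index.
Qed.

Lemma box_subgroup_trivial g : (forall i, g \in box_subgroup i) -> g = 1.
Proof.
move=> gK; rewrite (semidirectE sdp g).
have -> : gpart g = 1.
  by apply: P_trivial => i; have /extensionP[/normalIP[]] := gK i.
have -> : fpart g = 1.
  apply: (homology_tower_trivial fB gB) => -[|i]; first exact/make_normalP.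
  by have /extensionP[] := gK i.
by rewrite (morph1 (@gmulfM _ _ iota)) (morph1 (@gmulfM _ _ sigma)) mulg1.
Qed.

(** Deep in the chain, a given finite set injects into the quotient. *)
Lemma complement_chain_separates (A : seq G) :
  exists I, forall i, I <= i -> {in A &, injective (coset (complement_chain i))}.
Proof.
have [x m n mn xm|x _|I IP] := bound_seq (s := [seq a^-1 * b | a <- A, b <- A])
    (P := fun x n => x <> 1 -> forall i, n <= i -> x \notin complement_chain i).
- by move=> x1 i ni; apply: xm => //; exact: leq_trans ni.
- have [->|x1] := pselect (x = 1); first by exists 0%N.
  have [n xn] : exists n, x \notin complement_chain n.
    apply: contrapT => none; apply: x1; apply: P_trivial => i.
    suff : x \in complement_chain i by move=> /normalIP[].
    by apply/negPn/negP => xi; apply: none; exists i.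
  by exists n => _ i ni; apply: contra xn; exact: complement_chain_sub.
exists I => i Ii a b aA bA /cosetP ab; apply: contrapT => nab.
have ab1 : a^-1 * b <> 1 by move=> /mulg1_eq; rewrite invgK.
exact: (negP (IP _ (allpairs_f (fun a b => a^-1 * b) aA bA) ab1 i Ii)).
Qed.

(** Choose the Folner set [A] first, then [L] bounding the [F]-parts of the
    generators after conjugation by [A], then [r] with [r ^ L] close to 1.  On
    a level [i] large for [A] and [r], a kernel value above 1/2 at [p], [q]
    writes [p^-1 q] as the class of [sigma a * iota z * (sigma b)^-1] with
    [a], [b] in [A] and [z] of length at most [m]. *)
Lemma box_kernels (eps : R) : (0 < eps)%R ->
  exists I t : nat, forall i, I <= i ->
    exists k, @kernel_at R Gamma S gS box_subgroup eps t i k.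
Proof.
move=> eps0; pose d : R := (eps / 2)%R; have d0 : (0 < d)%R by rewrite divr_gt0.
have [A A0 Afol] := amenG [fset (gpart s) | s in S]%fset d0.
have sA : (0 < size A)%N by rewrite cardfs_gt0.
have Afolner s : s \in S ->
    (1 - d <= (count (fun a => (gpart s * a)%g \in A) A)%:R / (size A)%:R)%R.
  move=> sS; apply: folner_count => //; apply: Afol.
  by apply/imfsetP; exists s.
have [x m n|x _|L LP] := bound_seq (s := [seq act a (fpart s) | s <- S, a <- A])
    (P := fun x n => word_ball B n x).
- exact: word_ball_le.
- by have [w [Bw ->]] := generates_word gB x; exists (size w), w.
have Lball s a : s \in S -> a \in A -> word_ball B L (act a (fpart s)).
  by move=> sS aA; apply: LP; exact: (allpairs_f (fun s a => act a (fpart s)) sS aA).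
pose h : R := (d / L.+1%:R)%R; have h0 : (0 < h)%R by rewrite divr_gt0// ltr0n.
pose r : R := ((1 + h)^-1)%R; have r01 : (0 <= r <= 1)%R := inv1D_bounds h0.
have rL : (1 - d <= r ^+ L)%R.
  apply: le_trans (inv1D_pow_ge h0 L); rewrite lerD2l lerN2 /h mulrCA ger_pMr//.
  by rewrite ler_pdivrMr ?ltr0n// mul1r ler_nat.
have [m mP] := inv1D_pow_small h0.
have [I0 I0P] := complement_chain_separates A.
have [x n1 n2 n12|x _|La LaP] := bound_seq (s := A : seq G)
    (P := fun a n => word_length gS (sigma a) <= n).
- by move=> xn; exact: leq_trans n12.
- by exists (word_length gS (sigma x)).
have [x n1 n2 n12|x _|C CP] := bound_seq (s := B)
    (P := fun s n => word_length gS (iota s) <= n).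
- by move=> xn; exact: leq_trans n12.
- by exists (word_length gS (iota x)).
exists (maxn I0 m), (La + m * C + La)%N => i; rewrite geq_max => /andP[I0i mi].
have [Es [uEs mEs]] := edge_enum B (homology_tower_finite_index fB gB i).
pose k := @average_kernel R F G Gamma iota sigma sdp B fB (N i) Es (complement_chain i)
  A r.
have uA : uniq A by exact: fset_uniq.
have A_inj := I0P i I0i.
have k_gram : gram k :=
  average_kernel_gram sdp fB Es (@complement_chain_finite_index i) A r01.
have k1 g : k g g = 1%R by exact: (average_kernel1 sdp fB Es uA sA A_inj).
have k_modr g x y : y \in box_subgroup i -> k g (x * y) = k g x.
  by move=> yK; exact: (average_kernel_modr (M_triv :=
    @complement_chain_triv i) fB Es A r g x yK).
exists (fun p q => k (repr p) (repr q)); split.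
- exact: gram_comp.
- by move=> p; exact: k1.
- move=> p s sS.
  have -> : k (repr p) (repr (p * coset (box_subgroup i) s)) = k (repr p) (repr p * s).
    rewrite -[repr (p * _)](mulVKg (repr p * s)) k_modr//.
    apply/cosetP; rewrite cosetM /coset !reprK//.
  have := average_kernel_near fB uEs mEs (complement_chain i) uA r01 (repr p) (fun a =>
    @Lball s a sS).
  apply: le_trans.
  have := Afolner s sS; move: rL.
  set x := (_ / _)%R; set y := (r ^+ L)%R => y1 x1.
  have x2 : (x <= 1)%R by rewrite ler_pdivrMr ?ltr0n// mul1r ler_nat count_size.
  (* [x * y >= x + y - 1] as [x] and [y] are at most 1 *)
  have y2 : (y <= 1)%R by have /andP[r0 r1] := r01; exact: exprn_ile1.
  have : (eps = 2 * d)%R by rewrite /d mulrC divfK.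
  by nra.
- move=> p q /(average_kernel_far uA sA A_inj)[a [b [aA bA abM /mP abm]]].
  have [z zm zN] := homology_subgroup_close gB uEs mEs (homology_tower_girth_le fB mi)
    abm.
  have E : p * coset _ (sigma a * iota z) = q * coset (box_subgroup i) (sigma b).
    rewrite -[p]reprK -[q]reprK -!cosetM; apply/cosetP/extensionP.
    apply: (in_extension_eq (@complement_chain_triv i)).
      by rewrite !gpartM !gpart_sigma gpart_iota mulg1 abM.
    rewrite !fpartM !gpartM !gpart_sigma !fpart_sigma gpart_iota fpart_iota mulg1 act1
      !mulg1.
    by rewrite mul1g; apply/cosetP.
  have -> : (word_dist (@generates_quotient _ _ gS (box_subgroup i)) p q =
      word_length (@generates_quotient _ _ gS (box_subgroup i))
       (coset _ (sigma a * iota z * (sigma b)^-1)))%N.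
    rewrite /word_dist; congr word_length.
    rewrite cosetM cosetV; apply: (@mulgI _ p); rewrite mulVKg mulgA E.
    by rewrite mulgK.
  apply: leq_trans (word_length_coset _ _ _) _.
  apply: leq_trans (word_lengthM _ _ _) _; apply: leq_add; last first.
    by rewrite word_lengthV; exact: LaP.
  apply: leq_trans (word_lengthM _ _ _) _; apply: leq_add; first exact: LaP.
  exact: (word_length_ball CP zm).
Qed.

End Main.

Theorem mainTheorem3 (R : realType) (F G Gamma : groupType)
    (iota : {multiplicative F -> Gamma}) (sigma : {multiplicative G -> Gamma})
    (freeF : free_group F) (fgF : finitely_generated F)
    (fgG : finitely_generated G) (rfG : residually_finite G)
    (amenG : amenable R G)
    (sdp : semidirect_product iota sigma)
    (S : seq Gamma) (gS : generates S) :
  exists K : nat -> normalSubgroup Gamma,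
    [/\ forall i, {subset K i.+1 <= K i},
        forall i, finite_index (K i),
        forall g, (forall i, g \in K i) -> g = 1
      & forall c : box_gaps R gS K, embeds_coarsely_in_Hilbert (box_space c)].
Proof.
have [B [fB gB]] := finite_free_basis freeF fgF.
have [P [P_sub P_finite P_trivial]] := residual_chain fgG rfG.
exists (box_subgroup sdp P); split.
- exact: box_subgroup_sub.
- exact: box_subgroup_finite_index.
- exact: box_subgroup_trivial.
- move=> c; apply: box_space_embeds.
    exact: box_subgroup_finite_index.
  exact: box_kernels.
Qed.
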